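(* Let $(X,m,E)$ and $(X',m',E')$ be two universal measurable graphs. Then $\mu_{\{X,m,E\}}=\mu_{\{X',m',E'\}}$ if and only if the two graphs are isomorphic in the following sense: there exists a measure-preserving map $T:(X,m)\to(X',m')$ (so $Tm=m'$) such that, for $(m\times m)$-almost all $(x,y)\in X\times X$, $$(x,y)\in E\iff (Tx,Ty)\in E'.$$
   Context: Graphs are undirected, without loops or multiple edges. Graphs with vertex set $\mathbb{N}$ are identified with their adjacency matrices, i.e. infinite symmetric $\{0,1\}$-matrices with zero diagonal, with the weak (product) topology and its Borel $\sigma$-field. A countable graph $\Gamma$ is universal (homogeneous) if every finite graph embeds in $\Gamma$ as an induced subgraph and every isomorphism between two finite induced subgraphs of $\Gamma$ extends to an automorphism of $\Gamma$. A measurable graph is a triple $(X,m,E)$ where $(X,m)$ is a standard Lebesgue space with continuous (atomless) probability measure $m$ and $E\subset X\times X$ is a symmetric measurable set of positive $(m\times m)$-measure; $E$ is considered up to sets of zero measure. Put $E_x=\{y:(x,y)\in E\}$. It is pure if the map $x\mapsto E_x\pmod 0$ from $X$ to the algebra of mod $0$ classes of measurable sets is injective mod $0$, i.e. injective on a set of full measure. A universal measurable graph is a pure measurable graph such that for $m^{\infty}$-almost all sequences $(x_k)_{k\ge1}\in X^{\infty}$ the graph induced by $E$ on the vertices $x_1,x_2,\dots$ is a universal countable graph. $\mu_{\{X,m,E\}}$ denotes the image of the Bernoulli measure $m^{\infty}$ on $X^{\infty}$ under the map $(x_i)_i\mapsto (e_{i,j})_{i,j\in\mathbb{N}}$, $e_{i,j}=\chi_E(x_i,x_j)$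 for $i\neq j$, $e_{i,i}=0$, where $\chi_E$ is the characteristic function of $E$. *)

(* Defs.v *)
From HB Require Import structures.
From mathcomp Require Import all_boot all_order all_algebra.
From mathcomp Require Import all_classical all_reals all_analysis.
From mathcomp Require Import measurable_realfun.
Set Implicit Arguments.
Unset Strict Implicit.
Unset Printing Implicit Defensive.
Import Order.TTheory GRing.Theory Num.Theory numFieldNormedType.Exports.

Local Open Scope classical_set_scope.
Local Open Scope ring_scope.
Local Open Scope ereal_scope.

Definition sequences (X : Type) : Type := nat -> X.

HB.instance Definition _ (X : pointedType) :=
  Pointed.copy (sequences X) (nat -> X).

Definition sequences_display : measure_display -> measure_display.
Proof. exact. Qed.

Section sequences_measurable.
Context d (X : measurableType d).

Definition coordinate_events : set (set (sequences X)) :=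
  \bigcup_i preimage_set_system setT (fun x : sequences X => x i) measurable.

Let measurable_seq0 : <<s coordinate_events >> set0.
Proof. exact: sigma_algebra0. Qed.

Let measurable_seqC A :
  <<s coordinate_events >> A -> <<s coordinate_events >> (~` A).
Proof. exact: sigma_algebraC. Qed.

Let measurable_seq_bigcup (F : (set (sequences X))^nat) :
  (forall i, <<s coordinate_events >> (F i)) ->
  <<s coordinate_events >> (\bigcup_i F i).
Proof. exact: sigma_algebra_bigcup. Qed.

HB.instance Definition _ := @isMeasurable.Build (sequences_display d)
  (sequences X) <<s coordinate_events >>
  measurable_seq0 measurable_seqC measurable_seq_bigcup.

Lemma measurable_coord i : measurable_fun setT (fun x : sequences X => x i).
Proof.
move=> _ A mA; apply: sub_sigma_algebra; exists i => //.
by exists A.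
Qed.

Lemma measurable_fun_seq d' (T : measurableType d') (f : T -> sequences X) :
  (forall i, measurable_fun setT (fun t => f t i)) -> measurable_fun setT f.
Proof.
move=> mf; apply: (@measurability _ _ _ _ _ _ coordinate_events) => //.
move=> _ [_ [i _ [A mA <-]] <-].
by rewrite setTI; exact: mf.
Qed.

Definition scons (p : X * sequences X) : sequences X :=
  fun n => if n is k.+1 then p.2 k else p.1.

Lemma measurable_scons : measurable_fun setT scons.
Proof.
apply: measurable_fun_seq => -[|i] /=; first exact: measurable_fst.
exact: (measurableT_comp (measurable_coord i) measurable_snd).
Qed.

HB.instance Definition _ :=
  isMeasurableFun.Build _ _ _ _ scons measurable_scons.

End sequences_measurable.

Section cylinders.
Context d (X : measurableType d).

Definition cyl (n : nat) (A : set (sequences X)) : Prop :=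
  measurable A /\
  forall x y : sequences X, (forall i, (i < n)%N -> x i = y i) -> A x -> A y.

Definition cylinder (A : set (sequences X)) : Prop := exists n, cyl n A.

Lemma cyl_le n k A : (n <= k)%N -> cyl n A -> cyl k A.
Proof.
move=> nk [mA cA]; split=> // x y xy; apply: cA => i ilt.
by apply: xy; apply: leq_trans ilt nk.
Qed.

Lemma cylinder0 : cylinder set0.
Proof. by exists 0%N; split. Qed.

Lemma cylinderC A : cylinder A -> cylinder (~` A).
Proof.
move=> [n [mA cA]]; exists n; split; first exact: measurableC.
by move=> x y xy nAx Ay; apply: nAx; apply: cA Ay => i /xy.
Qed.

Lemma cylinderU A B : cylinder A -> cylinder B -> cylinder (A `|` B).
Proof.
move=> [n cA] [k cB]; exists (maxn n k).
have [mA {}cA] := cyl_le (leq_maxl n k) cA.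
have [mB {}cB] := cyl_le (leq_maxr n k) cB.
split; first exact: measurableU.
by move=> x y xy [/(cA _ _ xy)|/(cB _ _ xy)]; [left|right].
Qed.

Definition section0 (y : X) (A : set (sequences X)) : set (sequences X) :=
  [set x | A (scons (y, x))].

Lemma measurable_scons1 (y : X) :
  measurable_fun setT (fun x : sequences X => scons (y, x)).
Proof.
by apply: measurableT_comp => //; exact: measurable_scons.
Qed.

Lemma cyl_section0 n y A : cyl n.+1 A -> cyl n (section0 y A).
Proof.
move=> [mA cA]; split.
  by rewrite -[section0 _ _]setTI; exact: measurable_scons1.
move=> x z xz; apply: cA => -[//|i] /=.
by rewrite ltnS; exact: xz.
Qed.

Lemma cylinder_section0 y A : cylinder A -> cylinder (section0 y A).
Proof.
by move=> [n cA]; exists n; apply: cyl_section0; exact: cyl_le cA.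
Qed.

End cylinders.

Definition cyl_algebra (X : Type) : Type := sequences X.
Definition cyl_display : measure_display -> measure_display.
Proof. exact. Qed.

HB.instance Definition _ (X : pointedType) := Pointed.on (cyl_algebra X).
HB.instance Definition _ d (X : measurableType d) :=
  @isAlgebraOfSets.Build (cyl_display d) (cyl_algebra X) (@cylinder d X)
  (@cylinder0 d X) (@cylinderU d X) (@cylinderC d X).

(* The infinite product m^oo (m \x m \x ...), by Caratheodory extension from
   the algebra of cylinders; bernoulli_measure_box below is the product formula
   characterizing it. *)
Section bernoulli_measure.
Context d (X : measurableType d) (R : realType) (m : probability X R).

(* The law of (x_0, ..., x_(n-1), point, point, ...) with the x_i i.i.d. *)
Fixpoint marginal (n : nat) : probability (sequences X) R :=
  match n return probability (sequences X) R with
  | 0%N => dirac (point : sequences X)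
  | k.+1 => distribution (m \x marginal k) (@scons d X)
  end.

Lemma marginalS n A : measurable A ->
  marginal n.+1 A = \int[m]_y marginal n (section0 y A).
Proof.
move=> mA; rewrite /= /distribution /pushforward /product_measure1.
apply: eq_integral => y _ /=; congr (marginal n _).
by rewrite xsectionE.
Qed.

Lemma marginal_stable n k A : cyl n A -> (n <= k)%N ->
  marginal k A = marginal n A.
Proof.
elim: n k A => [|n IH] k A cA nk.
  have [[x Ax]|A0] := pselect (A !=set0).
    have -> : A = setT.
      by rewrite -subTset => y _; apply: (cA.2 x).
    by rewrite !probability_setT.
  have -> : A = set0 by apply/seteqP; split=> // x Ax; apply: A0; exists x.
  by rewrite !measure0.
case: k nk => // k nk.
rewrite !marginalS; [|exact: cA.1..].
by apply: eq_integral => y _; apply: IH => //; exact: cyl_section0.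
Qed.

Definition premeasure (A : set (cyl_algebra X)) : \bar R :=
  marginal (get [set n | cyl n A]) A.

Lemma premeasureE n (A : set (cyl_algebra X)) :
  cyl n A -> premeasure A = marginal n A.
Proof.
move=> cA; rewrite /premeasure; set k := get _.
have ck : cyl k A by apply: (@getPex _ [set n | cyl n A]); exists n.
rewrite -(marginal_stable ck (leq_maxl k n)).
by rewrite -(marginal_stable cA (leq_maxr k n)).
Qed.

Lemma premeasure_ge0 A : 0 <= premeasure A.
Proof. exact: measure_ge0. Qed.

Lemma premeasure0 : premeasure set0 = 0.
Proof. exact: measure0. Qed.

Lemma measurable_marginal_section0 n A : measurable A ->
  measurable_fun setT ((fun y => marginal n (section0 y A)) : X -> \bar R).
Proof.
move=> mA.
have mB : measurable (@scons d X @^-1` A).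
  by rewrite -[_ @^-1` _]setTI; exact: measurable_scons.
have := measurable_fun_xsection (marginal n) mB.
apply: eq_measurable_fun => y _ /=.
by congr (marginal n _); rewrite xsectionE.
Qed.

(* A decreasing sequence of cylinders of mass at least p.2 > 0. *)
Let fat (p : (nat -> set (cyl_algebra X)) * R) : Prop :=
  [/\ (forall k, cylinder (p.1 k)),
      (forall k, p.1 k.+1 `<=` p.1 k),
      (0 < p.2)%R &
      (forall k, p.2%:E <= premeasure (p.1 k))].

Let fat_step p : fat p ->
  exists y : X, fat (fun k => section0 y (p.1 k), (p.2 / 2)%R).
Proof.
case: p => B e [/= cB dB e0 eB].
have e20 : (0 < e / 2)%R by exact: divr_gt0.
pose f k y := premeasure (section0 y (B k)).
have fE k : exists n, [/\ cyl n.+1 (B k),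
    f k = (fun y => marginal n (section0 y (B k))) &
    premeasure (B k) = \int[m]_y f k y].
  have [n cn] := cB k; have cn1 := cyl_le (leqnSn n) cn.
  have fk : f k = (fun y => marginal n (section0 y (B k))).
    by apply/funext => y; apply: premeasureE; exact: cyl_section0.
  exists n; split => //.
  by rewrite (premeasureE cn1) marginalS ?fk//; exact: cn1.1.
have mf k : measurable_fun setT (f k).
  have [n [[mBk _] -> _]] := fE k.
  exact: measurable_marginal_section0.
pose D k := [set y | (e / 2)%:E <= f k y].
have mD k : measurable (D k).
  by rewrite -[D k]setTI; apply: emeasurable_fun_c_infty.
have f1 k y : f k y <= 1.
  have [n [cn -> _]] := fE k; apply: probability_le1.
  exact: (cyl_section0 y cn).1.
have mD2 k : (e / 2)%:E <= m (D k).
  have [n [_ _ intf]] := fE k.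
  have : e%:E <= \int[m]_y ((\1_(D k) y)%:E + (e / 2)%:E).
    rewrite (le_trans (eB k))// intf; apply: ge0_le_integral => //.
    - apply: emeasurable_funD => //.
      by apply/measurable_EFinP; exact: measurable_indic.
    - move=> y _; rewrite indicE; have [yD|yD] := boolP (y \in D k).
        by rewrite (le_trans (f1 k y))//= leeDl// lee_fin ltW.
      rewrite add0e; move: yD; rewrite notin_setE /D /= => /negP.
      by rewrite -ltNge => /ltW.
  rewrite ge0_integralD//=.
  - rewrite integral_indic// setIT integral_cst//= probability_setT mule1.
    by rewrite -leeBlDr// -EFinB {1}(splitr e) addrK.
  - by apply/measurable_EFinP; exact: measurable_indic.
  - by move=> y _; rewrite lee_fin ltW.
have dD : nonincreasing_seq D.
  apply/nonincreasing_seqP => k; apply/subsetPset => y /= /le_trans; apply.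
  have [n [cn _ _]] := fE k; have [n' [cn' _ _]] := fE k.+1.
  have cu := cyl_le (leq_maxl n n') (cyl_section0 y cn).
  have cu' := cyl_le (leq_maxr n n') (cyl_section0 y cn').
  rewrite /f (premeasureE cu) (premeasureE cu') le_measure ?inE//.
  - exact: cu'.1.
  - exact: cu.1.
  - by move=> x; exact: dB.
have mI : measurable (\bigcap_k D k) by exact: bigcapT_measurable.
have cvgD : (m \o D) k @[k --> \oo] --> m (\bigcap_k D k).
  apply: nonincreasing_cvg_mu => //.
  by rewrite (le_lt_trans (probability_le1 m (mD 0%N)))// ltry.
have : 0 < m (\bigcap_k D k).
  apply: (@lt_le_trans _ _ (e / 2)%:E); first by rewrite lte_fin.
  rewrite -(cvg_lim (@ereal_hausdorff R) cvgD).
  by apply: lime_ge; [apply/cvg_ex; eexists; exact: cvgD|exact: nearW].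
have [[y Dy] _|D0] := pselect (\bigcap_k D k !=set0); last first.
  suff -> : \bigcap_k D k = set0 by rewrite measure0 ltxx.
  by apply/seteqP; split=> // y Dy; apply: D0; exists y.
exists y; split => //=.
- by move=> k; exact: cylinder_section0.
- by move=> k x; exact: dB.
- by move=> k; exact: Dy.
Qed.

Let cyl_point n (C : nat -> set (cyl_algebra X)) (y : sequences X) :
  (forall i, C i.+1 = section0 (y i) (C i)) -> cyl n (C 0%N) -> C n !=set0 ->
  C 0%N y.
Proof.
elim: n C y => [|n IH] C y CE cC Cn0.
  by case: Cn0 => x Cx; apply: cC.2 Cx.
have := IH (fun i => C i.+1) (fun i => y i.+1).
rewrite CE /section0 /= => /(_ (fun i => CE i.+1)).
have -> : scons (y 0%N, (fun i => y i.+1)) = y by apply/funext => -[].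
by apply => //; exact: cyl_section0.
Qed.

Lemma premeasure_continuous (B : nat -> set (cyl_algebra X)) (e : R) :
  (forall k, cylinder (B k)) -> (forall k, B k.+1 `<=` B k) ->
  (0 < e)%R -> (forall k, e%:E <= premeasure (B k)) ->
  \bigcap_k B k !=set0.
Proof.
move=> cB dB e0 eB.
have fB : fat (B, e) by [].
pose T := {p | fat p}.
pose good (s : T) (y : X) :=
  fat (fun k => section0 y ((sval s).1 k), ((sval s).2 / 2)%R).
have pick (s : T) : {y | good s y} by apply: cid; exact: fat_step (svalP s).
pose step (s : T) : T := exist fat _ (svalP (pick s)).
pose S n := iter n step (exist fat _ fB).
pose y n := sval (pick (S n)).
exists y => k _.
have [n cn] := cB k.
apply: (@cyl_point n (fun i => (sval (S i)).1 k) y) => //.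
have [_ _ p0 /(_ k) pk] := svalP (S n).
have [//|N0] := pselect ((sval (S n)).1 k !=set0).
suff E : (sval (S n)).1 k = set0.
  by move: pk; rewrite E premeasure0 lee_fin leNgt p0.
by apply/seteqP; split=> // x Ax; apply: N0; exists x.
Qed.

Lemma premeasure_fin A : cylinder A -> premeasure A \is a fin_num.
Proof.
by move=> [n cn]; rewrite (premeasureE cn) fin_num_measure//; exact: cn.1.
Qed.

Lemma premeasureU A B : cylinder A -> cylinder B -> A `&` B = set0 ->
  premeasure (A `|` B) = premeasure A + premeasure B.
Proof.
move=> [n cA] [k cB] AB0.
have {}cA := cyl_le (leq_maxl n k) cA.
have {}cB := cyl_le (leq_maxr n k) cB.
have cU : cyl (maxn n k) (A `|` B).
  split; first by apply: measurableU; [exact: cA.1|exact: cB.1].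
  by move=> x y xy [/(cA.2 _ _ xy)|/(cB.2 _ _ xy)]; [left|right].
rewrite (premeasureE cA) (premeasureE cB) (premeasureE cU).
by rewrite measureU//; [exact: cA.1|exact: cB.1].
Qed.

Lemma premeasure_sigma_additive : semi_sigma_additive premeasure.
Proof.
move=> F mF tF mUF.
pose U := \bigcup_k F k.
pose r n := U `\` \big[setU/set0]_(i < n) F i.
have mB n : cylinder (\big[setU/set0]_(i < n) F i).
  by apply: (@bigsetU_measurable _ (cyl_algebra X)) => i _; exact: mF.
have mr n : cylinder (r n).
  exact: (@measurableD _ (cyl_algebra X) _ _ mUF (mB n)).
have sumE n : \sum_(0 <= i < n) premeasure (F i) =
              premeasure (\big[setU/set0]_(i < n) F i).
  elim: n => [|n IH]; first by rewrite big_ord0 big_nil premeasure0.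
  rewrite big_nat_recr//= IH big_ord_recr/= premeasureU//; [exact: mB|exact: mF|].
  apply/seteqP; split=> // x []; rewrite -bigcup_mkord => -[i /= ltin Fi] Fn.
  have E := tF i n I I (ex_intro _ x (conj Fi Fn)).
  by rewrite E ltnn in ltin.
have UE n : premeasure U = \sum_(0 <= i < n) premeasure (F i) + premeasure (r n).
  rewrite sumE -premeasureU//; last exact: setDIK.
  congr premeasure; rewrite /r setDUK//.
  by move=> x /=; rewrite -bigcup_mkord => -[i _ Fi]; exists i.
have dr n : r n.+1 `<=` r n.
  by rewrite /r big_ord_recr/=; apply: setDS; exact: subsetUl.
have r0 : \bigcap_k r k = set0.
  apply/seteqP; split=> // x rx; have [[k _ Fk] _] := rx 0%N I.
  have [_] := rx k.+1 I; apply; rewrite -bigcup_mkord; exists k => //=.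
have rcvg : premeasure (r n) @[n --> \oo] --> 0.
  apply/fine_cvgP; split; first by apply: nearW => n; exact: premeasure_fin.
  apply/cvgrPdist_lt => /= e e0.
  have [k rk] : exists k, premeasure (r k) < e%:E.
    apply: contrapT => /forallNP H.
    have := premeasure_continuous mr dr e0.
    rewrite r0; case=> [k|x //]; rewrite leNgt; exact/negP/H.
  near=> n.
  have rn : premeasure (r n) < e%:E.
    apply: le_lt_trans rk.
    have kn : (k <= n)%N by near: n; exact: nbhs_infty_ge.
    rewrite -(subnKC kn); elim: (n - k)%N => [|j IH]; first by rewrite addn0.
    rewrite addnS (le_trans _ IH)//.
    rewrite -(setDUK (dr (k + j)%N)) premeasureU//; last exact: setDIK.
      by rewrite leeDl// premeasure_ge0.
    exact: (@measurableD _ (cyl_algebra X) _ _ (mr _) (mr _)).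
  rewrite sub0r normrN ger0_norm ?fine_ge0 ?premeasure_ge0//.
  by rewrite -lte_fin fineK// premeasure_fin.
have -> : (fun n => \sum_(0 <= i < n) premeasure (F i)) =
          (fun n => premeasure U - premeasure (r n)).
  by apply/funext => n; rewrite (UE n) addeK// premeasure_fin.
rewrite -[X in _ --> X]sube0.
by apply: cvgeB => //; [exact: fin_num_adde_defl|exact: cvg_cst].
Unshelve. all: by end_near. Qed.

HB.instance Definition _ := isMeasure.Build (cyl_display d) (cyl_algebra X) R
  premeasure premeasure0 premeasure_ge0 premeasure_sigma_additive.

Definition bernoulli_measure (A : set (sequences X)) : \bar R :=
  measure_extension premeasure A.

Lemma bernoulli_cylinder A : cylinder A -> bernoulli_measure A = premeasure A.
Proof. by move=> cA; exact: measurable_mu_extE. Qed.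

Lemma cylinder_coord i (B : set X) : measurable B ->
  cylinder [set x : sequences X | B (x i)].
Proof.
move=> mB; exists i.+1; split; last by move=> x y xy /=; rewrite xy.
by rewrite -[X in measurable X]setTI; exact: measurable_coord.
Qed.

Lemma measurable_seq_cyl (A : set (sequences X)) :
  measurable A -> (@measurable _ (cyl_algebra X)).-sigma.-measurable A.
Proof.
apply: smallest_sub; first exact: smallest_sigma_algebra.
move=> _ [i _ [B mB <-]]; rewrite setTI; apply: sub_sigma_algebra.
exact: cylinder_coord.
Qed.

Let bernoulli0 : bernoulli_measure set0 = 0.
Proof. exact: measure0. Qed.

Let bernoulli_ge0 A : 0 <= bernoulli_measure A.
Proof. exact: measure_ge0. Qed.

Let bernoulli_sigma_additive : semi_sigma_additive bernoulli_measure.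
Proof.
move=> F mF tF mUF.
pose C := g_sigma_algebraType (@measurable _ (cyl_algebra X)).
have := @measure_semi_sigma_additive _ C R (measure_extension premeasure) F.
apply => //.
- by move=> i; exact: measurable_seq_cyl.
- exact: measurable_seq_cyl.
Qed.

HB.instance Definition _ := isMeasure.Build _ _ _ bernoulli_measure
  bernoulli0 bernoulli_ge0 bernoulli_sigma_additive.

Let bernoulli_setT : bernoulli_measure setT = 1.
Proof.
rewrite bernoulli_cylinder; last by exists 0%N; split.
by rewrite (@premeasureE 0%N)//; exact: probability_setT.
Qed.

HB.instance Definition _ :=
  Measure_isProbability.Build _ _ _ bernoulli_measure bernoulli_setT.

Lemma bernoulli_measure_box n (B : nat -> set X) :
  (forall i, measurable (B i)) ->
  bernoulli_measure [set x | forall i, (i < n)%N -> B i (x i)] =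
  \prod_(i < n) m (B i).
Proof.
move=> mB; pose box k (B : nat -> set X) :=
  [set x : sequences X | forall i, (i < k)%N -> B i (x i)].
have cbox k C : (forall i, measurable (C i)) -> cyl k (box k C).
  move=> mC; split; last by move=> x y xy Bx i ik; rewrite -xy//; exact: Bx.
  have -> : box k C = \bigcap_(i in [set i | (i < k)%N]) [set x | C i (x i)].
    by apply/seteqP; split.
  by apply: bigcap_measurableType => i _; have [? []] := cylinder_coord i (mC i).
rewrite bernoulli_cylinder; last by exists n; exact: cbox.
rewrite (premeasureE (cbox n B mB)) -/(box n B).
elim: n B mB => [|n IH] C mC.
  rewrite big_ord0; have -> : box 0%N C = setT by apply/seteqP; split.
  exact: probability_setT.
rewrite marginalS; last exact: (cbox _ _ mC).1.
rewrite big_ord_recl /=.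
have -> : (fun y => marginal n (section0 y (box n.+1 C))) =
    (fun y => (\1_(C 0%N) y)%:E * \prod_(i < n) m (C i.+1)).
  apply/funext => y; rewrite indicE; have [yC|yC] := boolP (y \in C 0%N).
    rewrite mul1e -(IH (fun i => C i.+1))//; congr (marginal n _).
    apply/seteqP; split=> x /= H i ilt; first exact: (H i.+1).
    by case: i ilt => [_|i]; [exact: set_mem yC|exact: H].
  rewrite mul0e; have -> : section0 y (box n.+1 C) = set0.
    apply/seteqP; split=> // x /(_ 0%N erefl) /= Cy.
    by rewrite (mem_set Cy) in yC.
  exact: measure0.
rewrite ge0_integralZr//.
- by rewrite integral_indic// setIT.
- by apply/measurable_EFinP; exact: measurable_indic.
- by apply: prode_ge0 => i _; exact: measure_ge0.
Qed.

End bernoulli_measure.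

(* Isomorphism mod 0 between the restriction of m to A and that of n to B. *)
Definition iso_mod0 d d' (X : measurableType d) (Y : measurableType d')
    (R : realType) (m : set X -> \bar R) (A : set X)
    (n : set Y -> \bar R) (B : set Y) : Prop :=
  exists (X0 : set X) (Y0 : set Y) (f : X -> Y),
    [/\ [/\ measurable X0, X0 `<=` A & m (A `\` X0) = 0],
        [/\ measurable Y0, Y0 `<=` B & n (B `\` Y0) = 0],
        set_bij X0 Y0 f,
        (forall C, C `<=` X0 -> (measurable C <-> measurable (f @` C))) &
        (forall C, C `<=` X0 -> measurable C -> m C = n (f @` C))].

(* Lebesgue-Rokhlin probability spaces: complete, and isomorphic mod 0 to an
   interval [0, a] with (completed) Lebesgue measure together with an at most
   countable set S of atoms. *)
Definition lebesgue_space d (X : measurableType d) (R : realType)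
    (m : probability X R) : Prop :=
  measure_is_complete m /\
  exists (S : set X) (a : R),
    [/\ countable S,
        (forall x, S x -> measurable [set x] /\ 0 < m [set x]),
        (0 <= a)%R &
        iso_mod0 m (~` S) (@completed_lebesgue_measure R)
          [set t : R | (0 <= t <= a)%R]].

Definition atomless d (X : measurableType d) (R : realType)
    (m : set X -> \bar R) : Prop :=
  ~ exists A, [/\ measurable A, 0 < m A &
    forall B, measurable B -> B `<=` A -> m B = 0 \/ m B = m A].

(* The sets E are measurable for the uncompleted product sigma-algebra: this
   picks a representative of each class mod 0. *)
Definition measurable_graph d (X : measurableType d) (R : realType)
    (m : probability X R) (E : set (X * X)) : Prop :=
  [/\ lebesgue_space m,
      atomless m,
      measurable E,
      (forall x y, E (x, y) -> E (y, x)) &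
      0 < (m \x m) E].

Definition pure d (X : measurableType d) (R : realType)
    (m : probability X R) (E : set (X * X)) : Prop :=
  exists X0 : set X, [/\ measurable X0, m X0 = 1 &
    forall x y, X0 x -> X0 y ->
      m (xsection E x `+` xsection E y) = 0 -> x = y].

(* Infinite {0,1}-matrices, with the Borel sigma-algebra of the product
   topology. *)
Definition adjacency_matrix :=
  g_sigma_algebraType (@open {ptws nat * nat -> bool}).

Definition is_graph (g : adjacency_matrix) : Prop :=
  (forall i j, g (i, j) = g (j, i)) /\ (forall i, g (i, i) = false).

Definition embeds_finite_graphs (g : adjacency_matrix) : Prop :=
  forall (V : finType) (e : rel V), symmetric e -> irreflexive e ->
    exists f : V -> nat,
      injective f /\ (forall u v, g (f u, f v) = e u v).

Definition homogeneous_graph (g : adjacency_matrix) : Prop :=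
  forall (A B : set nat) (f : nat -> nat),
    finite_set A -> set_bij A B f ->
    (forall i j, A i -> A j -> g (f i, f j) = g (i, j)) ->
    exists s : nat -> nat,
      [/\ bijective s,
          (forall i j, g (s i, s j) = g (i, j)) &
          (forall i, A i -> s i = f i)].

Definition universal_graph (g : adjacency_matrix) : Prop :=
  [/\ is_graph g, embeds_finite_graphs g & homogeneous_graph g].

Definition induced_graph (X : Type) (E : set (X * X)) (x : sequences X) :
    adjacency_matrix :=
  fun ij => (ij.1 != ij.2) && ((x ij.1, x ij.2) \in E).

Definition universal_measurable_graph d (X : measurableType d) (R : realType)
    (m : probability X R) (E : set (X * X)) : Prop :=
  [/\ measurable_graph m E,
      pure m E &
      {ae bernoulli_measure m, forall x, universal_graph (induced_graph E x)}].

Definition graph_law d (X : measurableType d) (R : realType)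
    (m : probability X R) (E : set (X * X)) : set adjacency_matrix -> \bar R :=
  pushforward (bernoulli_measure m) (induced_graph E).

Definition measurable_graph_iso d d' (X : measurableType d)
    (X' : measurableType d') (R : realType) (m : probability X R)
    (E : set (X * X)) (m' : probability X' R) (E' : set (X' * X')) : Prop :=
  exists T : X -> X',
    [/\ measurable_fun setT T,
        (forall A, measurable A -> m (T @^-1` A) = m' A) &
        {ae m \x m, forall p, E p <-> E' (T p.1, T p.2)}].

(* Main.v *)
Require Import Defs.
From HB Require Import structures.
From mathcomp Require Import all_boot all_order all_algebra.
From mathcomp Require Import all_classical all_reals all_analysis.
From mathcomp Require Import measurable_realfun.
From mathcomp Require Import ring.

(* Sample x in X^oo.  The type of z in X is the 0-1 sequence recording to which
   x_k it is adjacent.  By the law of large numbers the graph induced on x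
   determines the law of the types, and, applied to y, x_0, x_1, ..., the
   measures of the traces of E_y on the sets of points with a given initial
   type, for almost every y.  The sections E_y form a separable set and x meets
   every part of it of positive mass, so almost every E_y is a limit of the
   sets E_(x_k); with purity this makes types injective on a set of full
   measure.  If the laws agree, inner regularity of X'^oo with respect to a
   compact class yields good samples x in X^oo and x' in X'^oo with the same
   graph, and T sends y to the almost surely unique point of X' whose type with
   respect to x' is the type of y with respect to x.  Inner regularity of X'
   shows that T is defined almost everywhere, and, with completeness of X, that
   it is measurable and measure preserving.  Finally E_y and T^-1(E'_(T y)) have
   traces of equal measure on every E_(x_k), hence agree mod 0. *)

Set Implicit Arguments.
Unset Strict Implicit.
Unset Printing Implicit Defensive.
Import Order.TTheory GRing.Theory Num.Theory numFieldNormedType.Exports.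

Local Open Scope classical_set_scope.
Local Open Scope ring_scope.
Local Open Scope ereal_scope.

(** * Bernoulli measures *)

Section bernoulli_theory.
Context d (X : measurableType d) (R : realType) (m : probability X R).
Implicit Types (A : set (sequences X)) (B : set X).

(** Cylinders are stable under intersection and generate the sigma-algebra, so the uniqueness
    theorem for measures on a pi-system applies. *)
Lemma bernoulli_unique (nu : {measure set (sequences X) -> \bar R}) :
  (forall A, cylinder A -> nu A = bernoulli_measure m A) ->
  forall A, measurable A -> nu A = bernoulli_measure m A.
Proof.
move=> nuE; apply: (@measure_unique _ _ _ (@cylinder _ X) (fun=> setT)).
- apply/seteqP; split => A; first exact: measurable_seq_cyl.
  apply: smallest_sub; first exact: sigma_algebra_measurable.
  by move=> C [n [mC _]].
- move=> A C cA cC; rewrite -[A `&` C]setCK setCI.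
  by apply: cylinderC; apply: cylinderU; exact: cylinderC.
- by move=> _; exists 0%N; split.
- by rewrite bigcup_const//; exists 0%N.
- exact: nuE.
- by move=> _; rewrite nuE ?probability_setT ?ltry//; exists 0%N; split.
Qed.

Lemma bernoulli_marginal n A : cyl n A ->
  bernoulli_measure m A = marginal m n A.
Proof.
by move=> cA; rewrite bernoulli_cylinder ?(premeasureE _ cA)//; exists n.
Qed.

(** Peeling off the first coordinate: this is what drives the inductions on prefix length and the
    Fubini arguments on a sample prolonged by one point. *)
Lemma bernoulli_scons A : measurable A ->
  bernoulli_measure m A = (m \x bernoulli_measure m) (@scons d X @^-1` A).
Proof.
move=> mA; apply/esym.
apply: (bernoulli_unique (nu := distribution (m \x bernoulli_measure m)%E (@scons d X))) => //.
move=> {mA}A [n cA]; have cA1 := cyl_le (leqnSn n) cA.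
rewrite /= /distribution /pushforward /= /product_measure1.
rewrite (bernoulli_marginal cA1) marginalS; last exact: cA1.1.
apply: eq_integral => y _ /=; rewrite xsectionE.
exact/bernoulli_marginal/cyl_section0.
Qed.

Lemma ge0_integral_scons (f : sequences X -> \bar R) :
  measurable_fun setT f -> (forall x, 0 <= f x) ->
  \int[bernoulli_measure m]_x f x =
  \int[m]_y \int[bernoulli_measure m]_x f (scons (y, x)).
Proof.
move=> mf f0.
have mfs : measurable_fun setT (f \o @scons d X).
  by apply: measurableT_comp => //; exact: measurable_scons.
have /= <- := @fubini_tonelli1 _ _ _ _ _ m (bernoulli_measure m) _ mfs (fun=> f0 _).
rewrite -ge0_integral_distribution//.
by apply: eq_measure_integral => A mA _; exact: bernoulli_scons.
Qed.

Lemma bernoulli_box2 i j B C : (i < j)%N -> measurable B -> measurable C ->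
  bernoulli_measure m [set x | B (x i) /\ C (x j)] = m B * m C.
Proof.
move=> ij mB mC.
pose D k := if k == i then B else if k == j then C else setT.
have mD k : measurable (D k) by rewrite /D; case: ifP => // _; case: ifP.
have -> : [set x : sequences X | B (x i) /\ C (x j)] =
    [set x | forall k, (k < j.+1)%N -> D k (x k)].
  apply/seteqP; split=> x /= => [[Bx Cx] k _|H].
    by rewrite /D; case: eqP => [->//|_]; case: eqP => [->|].
  split; first by have := H i; rewrite /D eqxx; apply; exact: ltnW.
  by have := H j; rewrite /D eqxx gtn_eqF//; apply.
rewrite bernoulli_measure_box// big_ord_recr /= {2}/D eqxx gtn_eqF//.
congr (_ * _).
rewrite (bigD1 (Ordinal ij))//= {1}/D eqxx big1 ?mule1// => k ki.
rewrite /D; case: eqP => [kE|_].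
  by move: ki; rewrite (_ : k = Ordinal ij) ?eqxx//; exact: val_inj.
by rewrite ltn_eqF// probability_setT.
Qed.

Lemma bernoulli_coord i B : measurable B ->
  bernoulli_measure m [set x | B (x i)] = m B.
Proof.
move=> mB; rewrite -[RHS]mule1 -(@probability_setT _ _ _ m).
rewrite -(bernoulli_box2 (ltnSn i) mB measurableT).
by congr bernoulli_measure; apply/seteqP; split => x //= [].
Qed.

End bernoulli_theory.

(** * The law of large numbers along powers of 2 *)

Section law_of_large_numbers.
Context d (X : measurableType d) (R : realType) (m : probability X R).

(** The second moments are summable, so the sum of the squares is integrable, hence finite almost
    everywhere, and the terms of a convergent series tend to 0. *)
Lemma ae_cvg0_of_second_moments d' (T : measurableType d') (P : probability T R)
    (f : nat -> T -> R) :
  (forall l, measurable_fun setT (f l)) ->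
  (forall l, \int[P]_t ((f l t) ^+ 2)%:E <= ((1 / 2 ^+ l)%R)%:E) ->
  {ae P, forall t, f l t @[l --> \oo] --> (0 : R)%R}.
Proof.
move=> mf fle; pose g t := \sum_(l <oo) ((f l t) ^+ 2)%:E.
have mf2 l : measurable_fun setT (fun t => ((f l t) ^+ 2)%:E).
  by apply/measurable_EFinP; exact: measurable_funX.
have f20 l t : 0 <= ((f l t) ^+ 2)%:E by rewrite lee_fin sqr_ge0.
have g0 t : 0 <= g t by apply: nneseries_ge0.
have mg : measurable_fun setT g by exact: ge0_emeasurable_sum.
have gint : P.-integrable setT g.
  apply/integrableP; split => //.
  under eq_integral do rewrite gee0_abs//.
  rewrite /g integral_nneseries//; apply: (@le_lt_trans _ _ (2%:E)).
    apply: lime_le; first by apply: is_cvg_nneseries => *; apply: integral_ge0 => *; exact: f20.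
    near=> n; apply: (@le_trans _ _ (\sum_(0 <= l < n) (1 / 2 ^+ l)%:E)).
      by apply: lee_sum => l _; exact: fle.
    rewrite sumEFin lee_fin.
    have -> : (\sum_(0 <= i < n) 1 / 2 ^+ i = 2 - 2 / 2 ^+ n :> R)%R.
      elim: {+}n => [|k IH]; first by rewrite big_nil expr0 divr1 subrr.
      by rewrite big_nat_recr//= IH exprS; field; rewrite expf_neq0.
    by rewrite gerBl divr_ge0// exprn_ge0.
  by rewrite ltry.
have := integrable_ae measurableT gint.
apply: filterS => t /(_ I) gt.
have goo : g t < +oo by rewrite -ge0_fin_numE.
have /= := nneseries_tail_cvg goo (fun l _ => f20 l t).
move=> /fine_cvgP[[n0 _ Hfin]] /cvgrPdist_lt H.
apply/cvgrPdist_lt => e e0.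
have e20 : (0 < e ^+ 2)%R by rewrite exprn_gt0.
have := H _ e20; apply: filter_app; exists n0 => // n /= nn0.
rewrite !sub0r !normrN => Hn.
(* A square is at most the tail of the series that it begins. *)
have : ((f n t) ^+ 2 < e ^+ 2)%R.
  apply: le_lt_trans (le_lt_trans (ler_norm _) Hn) => /=.
  rewrite -lee_fin fineK; last exact: Hfin.
  rewrite (nneseries_split _ 1)//.
  by rewrite addn1 big_nat1 leeDl// nneseries_ge0.
by rewrite -real_normK ?num_real// ltr_pXn2r// ?nnegrE// ltW.
Unshelve. all: by end_near. Qed.

(** A variance bound by pairwise independence. With p the measure of D, expanding the squared count
    gives at most 1 for each of the N diagonal terms and p * p for every other pair. *)
Lemma second_moment0 (D : set X) N : measurable D ->
  \int[bernoulli_measure m]_x ((\sum_(j < N) (\1_D (x j) : R)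
    - N%:R * fine (m D)) ^+ 2)%R%:E <= N%:R%:E.
Proof.
move=> mD; set P := bernoulli_measure m; set p := fine (m D).
have mDp : m D = p%:E by rewrite fineK// fin_num_measure.
have p0 : (0 <= p)%R by rewrite fine_ge0.
pose c (x : sequences X) := (\sum_(j < N) (\1_D (x j) : R))%R.
have c0 x : (0 <= c x)%R by apply: sumr_ge0.
have mj (j : nat) : measurable_fun setT (fun x : sequences X => (\1_D (x j) : R)).
  by apply: (measurableT_comp (measurable_indic _) (measurable_coord j)).
have mc : measurable_fun setT c by exact: measurable_sum.
have IE A : measurable A -> \int[P]_x (\1_A x)%:E = P A.
  by move=> mA; rewrite integral_indic// setIT.
have mcoord (j : nat) : measurable [set x : sequences X | D (x j)].
  by have [? [mA _]] := cylinder_coord j mD; exact: mA.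
have cE : \int[P]_x (c x)%:E = (N%:R * p)%:E.
  under eq_integral do rewrite -sumEFin.
  rewrite ge0_integral_sum//; last first.
    by move=> j; apply/measurable_EFinP; exact: mj.
  rewrite (eq_bigr (fun=> p%:E)).
    by rewrite sumEFin sumr_const card_ord mulr_natl.
  move=> j _; rewrite -mDp -(bernoulli_coord m j mD) -/P -IE//.
have c2E : \int[P]_x ((c x) ^+ 2)%:E <= (N%:R + (N%:R * p) ^+ 2)%:E.
  have -> : (fun x => ((c x) ^+ 2)%:E) = (fun x => \sum_(i < N) \sum_(j < N)
      (\1_D (x i) * \1_D (x j))%:E).
    apply/funext => x; under eq_bigr do rewrite sumEFin.
    rewrite sumEFin; congr (_%:E); rewrite expr2 /c mulr_suml.
    by apply: eq_bigr => i _; rewrite mulr_sumr.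
  have mij (i j : nat) : measurable_fun setT
      (fun x : sequences X => (\1_D (x i) * \1_D (x j) : R)%:E).
    by apply/measurable_EFinP; exact: measurable_funM.
  have ij0 (i j : nat) (x : sequences X) : 0 <= (\1_D (x i) * \1_D (x j) : R)%:E.
    by rewrite lee_fin mulr_ge0.
  have lt2 (i j : nat) : (i < j)%N ->
      \int[P]_x (\1_D (x i) * \1_D (x j) : R)%:E = (p * p)%:E.
    move=> ij; rewrite EFinM -mDp -(bernoulli_box2 m ij mD mD) -/P -IE.
      apply: eq_integral => x _; congr (_%:E); rewrite !indicE -natrM mulnb.
      by congr ((nat_of_bool _)%:R); apply/andP/idP; rewrite !inE.
    exact: (measurableI _ _ (mcoord i) (mcoord j)).
  rewrite ge0_integral_sum//; last 2 first.
  - by move=> i; exact: emeasurable_sum.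
  - by move=> i x _; exact: sume_ge0.
  apply: (@le_trans _ _ (\sum_(i < N) (1 + N%:R * (p * p))%:E)).
    apply: lee_sum => i _; rewrite ge0_integral_sum//.
    (* Diagonal terms are overestimated by 1 + p * p, so that a single formula covers all pairs. *)
    apply: (@le_trans _ _ (\sum_(j < N) ((i == j)%:R + p * p)%:E)).
      apply: lee_sum => j _; case: (ltngtP i j) => [ij|ij|ij].
      - by rewrite (lt2 _ _ ij) lee_fin lerDr.
      - under eq_integral do rewrite mulrC.
        by rewrite (lt2 _ _ ij) lee_fin lerDr.
      - rewrite (val_inj ij) eqxx (@le_trans _ _ (\int[P]_x (cst 1%:E x)))//.
          apply: ge0_le_integral => // x _ /=; rewrite lee_fin indicE.
          by case: (_ \in _); rewrite ?mulr1 ?mulr0.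
        by rewrite integral_cst//= probability_setT mule1 lee_fin lerDl mulr_ge0.
    rewrite sumEFin lee_fin big_split/= sumr_const card_ord -[in leLHS]mulr_natl.
    rewrite lerD2r (bigD1 i)//= eqxx big1 ?addr0// => j.
    by rewrite eq_sym => /negbTE ->.
  rewrite sumEFin lee_fin sumr_const card_ord -[leLHS]mulr_natr.
  by rewrite le_eqVlt; apply/orP; left; apply/eqP; ring.
(* Adding 2 N p c to (c - N p)^2 leaves only nonnegative terms to integrate. *)
have key : \int[P]_x ((c x - N%:R * p) ^+ 2)%:E +
     (2 * (N%:R * p) * (N%:R * p))%:E <=
     (N%:R + 2 * (N%:R * p) ^+ 2)%:E.
  rewrite [X in _ + X]EFinM -cE -ge0_integralZl_EFin//; last 3 first.
  - by move=> x _; rewrite lee_fin.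
  - exact/measurable_EFinP.
  - by rewrite !mulr_ge0.
  rewrite -ge0_integralD//; last 4 first.
  - by move=> x _; rewrite lee_fin sqr_ge0.
  - apply/measurable_EFinP; apply: measurable_funX; exact: measurable_funB.
  - by move=> x _; rewrite -EFinM lee_fin !mulr_ge0.
  - by apply/measurable_EFinP; exact: measurable_funM.
  rewrite (eq_integral (fun x => ((c x) ^+ 2)%:E + cst ((N%:R * p) ^+ 2)%:E x)).
    rewrite ge0_integralD//; last 3 first.
    - by move=> x _; rewrite lee_fin sqr_ge0.
    - by apply/measurable_EFinP; exact: measurable_funX.
    - by move=> x _; rewrite lee_fin sqr_ge0.
    rewrite integral_cst//= probability_setT mule1.
    by rewrite (mulr_natl (_ ^+ 2)) mulr2n addrA EFinD leeD2r.
  by move=> x _; rewrite /= -EFinM -!EFinD; congr (_%:E); ring.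
move: key; rewrite -leeBrDr//; rewrite -EFinB => /le_trans; apply.
by rewrite lee_fin expr2 mulrA addrK.
Qed.

End law_of_large_numbers.

Section prefix_law_of_large_numbers.
Context d (X : measurableType d) (R : realType) (m : probability X R).

(** For such D the section at x is fixed by the first n coordinates, hence independent of the
    samples from index n on, which are those counted in [deviation]. *)
Definition depends_on_prefix n (D : set (sequences X * X)) := forall x x' z,
  (forall i, (i < n)%N -> x i = x' i) -> D (x, z) -> D (x', z).

Definition deviation n (D : set (sequences X * X)) N (x : sequences X) : R :=
  (\sum_(j < N) \1_D (x, x (n + j)%N) - N%:R * fine (m (xsection D x)))%R.

Lemma measurable_deviation n D N : measurable D ->
  measurable_fun setT (deviation n D N).
Proof.
move=> mD; apply: measurable_funB.
  apply: measurable_sum => j.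
  apply: (measurableT_comp (measurable_indic _)) => //.
  by apply: measurable_fun_pair => //; exact: measurable_coord.
apply: measurable_funM => //.
by apply: measurableT_comp => //; exact: measurable_fun_xsection.
Qed.

(** Conditioning on the first coordinate y replaces D by a set depending on one coordinate fewer; at
    n = 0 all sections coincide and [second_moment0] applies. *)
Lemma second_moment n D N : measurable D -> depends_on_prefix n D ->
  \int[bernoulli_measure m]_x ((deviation n D N x) ^+ 2)%:E <= N%:R%:E.
Proof.
elim: n D => [|n IH] D mD Dn.
  have DE x x' : xsection D x = xsection D x'.
    by apply/seteqP; split => z; rewrite /xsection/= !inE; exact: Dn.
  have := second_moment0 m N (measurable_xsection point mD).
  congr (_ <= _); apply: eq_integral => x _; rewrite /deviation (DE x point).
  congr (((_ - _) ^+ 2)%:E); apply: eq_bigr => j _.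
  by rewrite add0n !indicE -[in RHS]mem_xsection (DE x point).
rewrite ge0_integral_scons; last 2 first.
- by apply/measurable_EFinP; apply: measurable_funX; exact: measurable_deviation.
- by move=> x; rewrite lee_fin sqr_ge0.
pose Dy y := [set p : sequences X * X | D (scons (y, p.1), p.2)].
have mDy y : measurable (Dy y).
  have : measurable_fun setT (fun p : sequences X * X => (scons (y, p.1), p.2)).
    apply: measurable_fun_pair => //.
    exact: (measurableT_comp (measurable_scons1 y) measurable_fst).
  by move=> /(_ measurableT _ mD); rewrite setTI.
apply: (@le_trans _ _ (\int[m]_y cst N%:R%:E y)); last first.
  by rewrite integral_cst//= probability_setT mule1.
apply: ge0_le_integral => //.
- by move=> y _; apply: integral_ge0 => x _; rewrite lee_fin sqr_ge0.
- apply: (@measurable_fun_fubini_tonelli_F _ _ _ _ _ (bernoulli_measure m)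
    (fun p : X * sequences X => ((deviation n.+1 D N (scons p)) ^+ 2)%:E)).
    apply/measurable_EFinP; apply: measurable_funX.
    by apply: measurableT_comp; [exact: measurable_deviation|exact: measurable_scons].
  by move=> x; rewrite lee_fin sqr_ge0.
- move=> y _; apply: (IH (Dy y) (mDy y)).
  by move=> x x' z xx'; apply: Dn => -[//|i]; rewrite ltnS => /xx'.
Qed.

(** With 2 ^ l samples the mean error has second moment at most 1 / 2 ^ l. Restricting to powers of
    2 makes these bounds summable. *)
Lemma law_of_large_numbers n D : measurable D -> depends_on_prefix n D ->
  {ae bernoulli_measure m, forall x : sequences X,
    ((\sum_(j < 2 ^ l) \1_D (x, x (n + j)%N)) / (2 ^ l)%:R)%R @[l --> \oo] -->
    fine (m (xsection D x))}.
Proof.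
move=> mD Dn; pose f l x := (deviation n D (2 ^ l) x / (2 ^ l)%:R)%R.
have N0 l : ((2 ^ l)%:R != 0 :> R)%R by rewrite pnatr_eq0 expn_eq0.
have : {ae bernoulli_measure m, forall x : sequences X, f l x @[l --> \oo] --> (0 : R)%R}.
  apply: ae_cvg0_of_second_moments => l.
    by apply: measurable_funM => //; exact: measurable_deviation.
  under eq_integral do rewrite /f expr_div_n mulrC EFinM.
  rewrite ge0_integralZl_EFin//; last 2 first.
  - by move=> x _; rewrite lee_fin sqr_ge0.
  - apply/measurable_EFinP; apply: measurable_funX.
    exact: measurable_deviation.
  apply: (@le_trans _ _ (((2 ^ l)%:R ^+ 2)^-1%:E * (2 ^ l)%:R%:E)).
    apply: lee_wpmul2l; first by rewrite lee_fin invr_ge0 sqr_ge0.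
    exact: second_moment.
  by rewrite -EFinM lee_fin expr2 invfM -mulrA mulVf// mulr1 div1r natrX.
apply: filterS => x /cvgrPdist_lt fx; apply/cvgrPdist_lt => e e0.
have := fx _ e0; apply: filterS => l.
rewrite sub0r normrN distrC /f /deviation.
by rewrite mulrBl [X in (_ - X)%R]mulrAC divff// mul1r.
Qed.

End prefix_law_of_large_numbers.

(** * Separability of the sections *)

Section symmetric_differences.
Context d (T : measurableType d) (R : realType) (P : probability T R).
Implicit Types A B C : set T.

Lemma le_measure_geometric_cover A (F : (set T)^nat) (e : R) :
  (0 <= e)%R -> measurable A -> (forall n, measurable (F n)) ->
  A `<=` \bigcup_n F n -> (forall n, P (F n) <= (e / 2 ^+ n.+1)%:E) ->
  P A <= e%:E.
Proof.
move=> e0 mA mF AF PF.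
apply: (le_trans (measure_sigma_subadditive P mF mA AF)).
apply: (@le_trans _ _ (\sum_(n <oo) (e / (2 ^ n.+1)%:R)%:E)).
  by apply: lee_nneseries => // n _; rewrite natrX; exact: PF.
exact: epsilon_trick0.
Qed.

Lemma measure_bigcup_tail (F : (set T)^nat) (e : R) :
  (forall n, measurable (F n)) -> (0 < e)%R ->
  exists N, P (\bigcup_n F n `\` \bigcup_(i in `I_N) F i) < e%:E.
Proof.
move=> mF e0; pose D N := \bigcup_n F n `\` \bigcup_(i in `I_N) F i.
have mD N : measurable (D N).
  by apply: measurableD; [exact: bigcupT_measurable|exact: bigcup_measurable].
have D0 : \bigcap_N D N = set0.
  apply/seteqP; split => // x Dx; have [[k _ Fk] _] := Dx 0%N I.
  by have [_] := Dx k.+1 I; apply; exists k => /=.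
have dD : nonincreasing_seq D.
  move=> a b ab; apply/subsetPset; apply: setDS => x [i /= ia Fi].
  by exists i => //=; exact: leq_trans ia ab.
have : P \o D @ \oo --> P (\bigcap_N D N).
  apply: nonincreasing_cvg_mu => //; last exact: bigcapT_measurable.
  by rewrite (le_lt_trans (probability_le1 P (mD 0%N)))// ltry.
rewrite D0 measure0 => /fine_cvgP[_ /cvgrPdist_lt /(_ _ e0)[N _ /(_ N (leqnn N))]].
rewrite /= sub0r normrN ger0_norm ?fine_ge0// => DN; exists N.
by rewrite -/(D N) -(@fineK _ (P (D N))) ?lte_fin// fin_num_measure.
Qed.

Lemma measurable_setY A B : measurable A -> measurable B -> measurable (A `+` B).
Proof. by move=> mA mB; apply: measurableU; exact: measurableD. Qed.

Lemma measure_setY_triangle A B C :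
  measurable A -> measurable B -> measurable C ->
  P (A `+` C) <= P (A `+` B) + P (B `+` C).
Proof.
move=> mA mB mC; have mAB := measurable_setY mA mB.
have mBC := measurable_setY mB mC; have mAC := measurable_setY mA mC.
apply: (@le_trans _ _ (P ((A `+` B) `|` (B `+` C)))); last exact: measureU2.
apply: le_measure; rewrite ?inE//; first exact: measurableU.
by move=> x /= [[Ax Cx]|[Cx Ax]]; have [Bx|Bx] := pselect (B x); tauto.
Qed.

Lemma measure_setY A B : measurable A -> measurable B ->
  P (A `+` B) + (P (A `&` B) + P (A `&` B)) = P A + P B.
Proof.
move=> mA mB; rewrite /setY measureU//; last 3 first.
- exact: measurableD.
- exact: measurableD.
- by apply/seteqP; split => x //= [[? ?] []].
by rewrite addeACA -measureDI// (setIC A) -measureDI.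
Qed.

(** By [measure_setY] the distance from a set to S is determined by its measure and by that of its
    trace on S. So A and B are equally far from S, and the triangle inequality through S bounds
    their distance. *)
Lemma measure_setY_eq0 A B : measurable A -> measurable B -> P A = P B ->
  (forall e : R, (0 < e)%R -> exists S, [/\ measurable S,
    P (A `&` S) = P (B `&` S) & P (A `+` S) < e%:E]) ->
  P (A `+` B) = 0.
Proof.
move=> mA mB PAB close; apply/eqP; rewrite eq_le measure_ge0 andbT.
apply/lee_addgt0Pr => e e0; rewrite add0e.
have e20 : (0 < e / 2)%R by exact: divr_gt0.
have [S [mS PABS PAS]] := close _ e20.
have PBS : P (B `+` S) = P (A `+` S).
  have := measure_setY mA mS; rewrite PAB -(measure_setY mB mS) PABS.
  have fI : P (B `&` S) + P (B `&` S) \is a fin_num.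
    by rewrite fin_numD fin_num_measure//; exact: measurableI.
  by move=> /(congr1 (fun t => t - (P (B `&` S) + P (B `&` S)))); rewrite !addeK.
rewrite (le_trans (measure_setY_triangle mA mS mB))// (setYC S) PBS.
by rewrite (splitr e) EFinD ltW// lteD.
Qed.

End symmetric_differences.

Lemma probability_setI1 d (T : measurableType d) (R : realType)
    (P : probability T R) A B : measurable A -> measurable B -> P B = 1 ->
  P (A `&` B) = P A.
Proof.
move=> mA mB B1; have AB0 : P (A `\` B) = 0.
  apply/eqP; rewrite eq_le measure_ge0 andbT.
  have <- : P (~` B) = 0 by rewrite probability_setC// B1 subee.
  by apply: le_measure; rewrite ?inE; [exact: measurableD|exact: measurableC|move=> t []].
by rewrite -[LHS]add0e -AB0 -measureDI.
Qed.

Section sections.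
Context d (X : measurableType d) (R : realType) (m : probability X R).

(** Sets with this approximation property include the rectangles and form a sigma-algebra; the
    approximating family depends on E but not on y. *)
Lemma separable_xsection (E : set (X * X)) : measurable E ->
  exists B : (set X)^nat, (forall l, measurable (B l)) /\
    forall y (e : R), (0 < e)%R -> exists l, m (xsection E y `+` B l) < e%:E.
Proof.
rewrite measurable_prod_measurableType.
suff : <<s [set A `*` B | A in measurable & B in measurable] >> `<=`
    [set E : set (X * X) | measurable E /\ exists B : (set X)^nat,
      (forall l, measurable (B l)) /\ forall y (e : R), (0 < e)%R ->
      exists l, m (xsection E y `+` B l) < e%:E].
  by move=> H /H [].
apply: smallest_sub; last first.
  move=> _ [A mA [B mB <-]]; split; first exact: measurableX.
  exists (fun l => if l is 0%N then B else set0); split; first by case.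
  move=> y e e0; have [yA|yA] := boolP (y \in A).
    by exists 0%N; rewrite in_xsectionX// setYK measure0 lte_fin.
  by exists 1%N; rewrite notin_xsectionX// setYK measure0 lte_fin.
split.
- split; first exact: measurable0.
  exists (fun=> set0); split => // y e e0; exists 0%N.
  by rewrite xsection0 setYK measure0 lte_fin.
- move=> D [mD [B [mB BE]]]; rewrite setTD; split; first exact: measurableC.
  exists (fun l => ~` B l); split; first by move=> l; exact: measurableC.
  move=> y e /(BE y) [l El]; exists l.
  have -> : xsection (~` D) y = ~` xsection D y.
    by apply/seteqP; split => z; rewrite /xsection /= !inE.
  by have -> : ~` xsection D y `+` ~` B l = xsection D y `+` B l
    by rewrite /setY !setDE !setCK setUC setIC (setIC (~` _)).
- move=> F FE; split; first by apply: bigcupT_measurable => i; have [] := FE i.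
  have /choice [B /all_and2 [mB BE]] i : exists B : (set X)^nat,
      (forall l, measurable (B l)) /\ forall y (e : R), (0 < e)%R ->
      exists l, m (xsection (F i) y `+` B l) < e%:E.
    by have [] := FE i.
  have mF i : measurable (F i) by have [] := FE i.
  (* Finite unions of approximants, one for each of the first [size s] sets. Finite sequences of
     indices are countable, so these unions form one sequence. *)
  pose C (s : seq nat) := \bigcup_(i in [set i | (i < size s)%N]) B i (nth 0%N s i).
  have mC s : measurable (C s) by apply: bigcup_measurable => i _; exact: mB.
  exists (fun l => C (odflt [::] (unpickle l))); split=> // y e e0.
  suff [s sP] : exists s, m (xsection (\bigcup_n F n) y `+` C s) < e%:E.
    by exists (pickle s); rewrite pickleK.
  pose A i := xsection (F i) y.
  have mA i : measurable (A i) by exact: measurable_xsection.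
  have e'0 : (0 < e / 2)%R by exact: divr_gt0.
  have [N AN] := measure_bigcup_tail m mA (divr_gt0 e'0 (ltr0n R 2)).
  have /choice [l lP] i : exists l, m (A i `+` B i l) < (e / 2 / 2 ^+ i.+2)%:E.
    by apply: BE; rewrite divr_gt0// exprn_gt0.
  exists (mkseq l N).
  apply: (@le_lt_trans _ _ (e / 2)%:E); last by rewrite lte_fin gtr_pMr// invf_lt1// ltr1n.
  (* [G 0] is the tail beyond N and [G i.+1] the error of the i-th approximant. Their bounds are
     geometric with sum e / 2, which leaves room for the strict inequality. *)
  pose G n := if n is i.+1 then A i `+` B i (l i) else
    \bigcup_n A n `\` \bigcup_(i in `I_N) A i.
  apply: (le_measure_geometric_cover (F := G)) => [| | |z|].
  - exact: ltW.
  - by apply: measurable_setY => //; exact/measurable_xsection/bigcupT_measurable.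
  - case=> [|i] /=; last by apply: measurable_setY.
    by apply: measurableD; [exact: bigcupT_measurable|exact: bigcup_measurable].
  - rewrite xsection_bigcup /C size_mkseq.
    move=> [[[i _ Ai] nB]|[[i /= iN Bi] nA]].
      have [[j /= jN Aj]|nAj] := pselect ((\bigcup_(i in `I_N) A i) z); last first.
        by exists 0%N => //; split => //; exists i.
      exists j.+1 => //; left; split => // Bj; apply: nB; exists j => //=.
      by rewrite nth_mkseq.
    exists i.+1 => //; right; rewrite nth_mkseq// in Bi; split => // Ai.
    by apply: nA; exists i.
  - case=> [|i] /=; first by rewrite expr1; exact: ltW.
    exact: ltW.
Qed.

End sections.

(** * Types and good samples *)

Section patterns.

(** Among words of length n any set B is a finite list, and lists are countable: [ae_typical] then
    has only countably many null sets to discard. *)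
Lemma seq_bool_finite n (B : set (seq bool)) :
  exists b : seq (seq bool), forall s, size s = n -> (s \in b) = (s \in B).
Proof.
exists [seq s <- map val (enum {: n.-tuple bool}) | s \in B] => s sn.
rewrite mem_filter andb_idr// => _.
by apply/mapP; exists (tcast sn (in_tuple s)); [rewrite mem_enum|rewrite /= val_tcast].
Qed.

Lemma measurable_pattern d (T : measurableType d) (F : nat -> T -> bool) n
    (B : set (seq bool)) : (forall k, measurable [set t | F k t]) ->
  measurable [set t | B (mkseq (F ^~ t) n)].
Proof.
move=> mF; elim: n B => [|n IH] B.
  rewrite /mkseq/=; have [B0|B0] := pselect (B [::]).
    by have -> : [set _ : T | B [::]] = setT by apply/seteqP; split.
  by have -> : [set _ : T | B [::]] = set0 by apply/seteqP; split.
have -> : [set t | B (mkseq (F ^~ t) n.+1)] =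
    [set t | F n t] `&` [set t | [set s | B (rcons s true)] (mkseq (F ^~ t) n)] `|`
    (~` [set t | F n t]) `&` [set t | [set s | B (rcons s false)] (mkseq (F ^~ t) n)].
  apply/seteqP; split=> t /=; rewrite mkseqS.
    by case: (F n t) => Bt; [left|right].
  by move=> [[->]|[/negP/negbTE ->]].
apply: measurableU; apply: measurableI => //; exact: measurableC.
Qed.

End patterns.

Section good_sequences.
Context d (X : measurableType d) (R : realType) (m : probability X R).
Variable E : set (X * X).
Hypothesis mE : measurable E.

Definition pattern (x : sequences X) n (z : X) : seq bool :=
  mkseq (fun k => (x k, z) \in E) n.

Definition pattern_set x n (B : set (seq bool)) : set X := pattern x n @^-1` B.

(* Only vertices with index at least n are sampled, so the diagonal of g is never
   read. *)
Definition frequency (g : adjacency_matrix) n (B : set (seq bool)) l : R :=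
  ((\sum_(j < 2 ^ l) \1_B (mkseq (fun k => g (k, (n + j)%N)) n)) / (2 ^ l)%:R)%R.

(** The frequencies are read off the graph alone, so samples with the same graph have the same
    limits: this is how measures pass from one space to the other. *)
Definition typical (x : sequences X) := forall n B,
  frequency (induced_graph E x) n B l @[l --> \oo] -->
  fine (m (pattern_set x n B)).

Definition dense_sections (x : sequences X) := {ae m, forall y, forall e : R, (0 < e)%R ->
  exists k, m (xsection E y `+` xsection E (x k)) < e%:E}.

Lemma measurable_pattern_set x n B : measurable (pattern_set x n B).
Proof.
apply: (measurable_pattern (F := fun k z => (x k, z) \in E)) => k.
rewrite (_ : [set _ | _] = xsection E (x k)); first exact: measurable_xsection.
by apply/seteqP; split => z; rewrite /xsection.
Qed.

Lemma pattern_vertex x n j :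
  mkseq (fun k => induced_graph E x (k, (n + j)%N)) n = pattern x n (x (n + j)%N).
Proof.
apply/eq_in_map => k; rewrite mem_iota add0n => /= kn.
by rewrite /induced_graph/= ltn_eqF// ltn_addr.
Qed.

Lemma ae_typical : {ae bernoulli_measure m, forall x : sequences X, typical x}.
Proof.
(* The code c of a list of words stands for B, so that the quantification is countable. *)
have H (n c : nat) : {ae bernoulli_measure m, forall x : sequences X,
    let b := odflt [::] (unpickle c) : seq (seq bool) in
    frequency (induced_graph E x) n [set` b] l @[l --> \oo] -->
    fine (m (pattern_set x n [set` b]))}.
  set b := odflt _ _; pose D := [set p | pattern p.1 n p.2 \in b].
  have mD : measurable D.
    suff mEk k : measurable [set p : sequences X * X | (p.1 k, p.2) \in E].
      exact: (measurable_pattern n [set` b] mEk).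
    have mf : measurable_fun setT (fun p : sequences X * X => (p.1 k, p.2)).
      apply: measurable_fun_pair => //.
      exact: (measurableT_comp (measurable_coord k) measurable_fst).
    have := mf measurableT _ mE; rewrite setTI; congr (measurable _).
    by apply/seteqP; split => p /=; rewrite inE.
  have Dn : depends_on_prefix n D.
    move=> x x' z xx'; rewrite /D/= /pattern.
    rewrite (_ : mkseq _ n = mkseq (fun k => (x' k, z) \in E) n)//.
    by apply/eq_in_map => k; rewrite mem_iota add0n => /= kn; rewrite xx'.
  have := law_of_large_numbers m mD Dn.
  apply: filterS => x xD /=.
  have -> : pattern_set x n [set` b] = xsection D x.
    by apply/seteqP; split => z; rewrite /xsection /= inE.
  apply: cvg_trans xD; apply: near_eq_cvg; apply: nearW => l.
  rewrite /frequency; congr (_ / _)%R; apply: eq_bigr => j _.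
  rewrite pattern_vertex !indicE; congr (_%:R).
have := ae_foralln (fun n => ae_foralln (H n)).
apply: filterS => x xH n B; have [b bB] := seq_bool_finite n B.
have sB (z : seq bool) : size z = n -> (z \in [set` b]) = (z \in B).
  by move=> zn; rewrite -bB//; apply/idP/idP; rewrite inE.
have := xH n (pickle b); rewrite pickleK /=.
have -> : pattern_set x n [set` b] = pattern_set x n B.
  have zn z : size (pattern x n z) = n by rewrite size_mkseq.
  apply/seteqP; split => z Bz; apply/set_mem.
    have : pattern x n z \in [set` b] by exact/mem_set.
    by rewrite sB// => /set_mem ?; exact/mem_set.
  have : pattern x n z \in B by exact/mem_set.
  by rewrite -sB// => /set_mem ?; exact/mem_set.
apply: cvg_trans; apply: near_eq_cvg; apply: nearW => l.
rewrite /frequency; congr (_ / _)%R; apply: eq_bigr => j _.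
by rewrite !indicE sB// size_mkseq.
Qed.

(** Otherwise the visit frequencies would be constantly 0 while tending to m Q. *)
Lemma ae_hits (Q : set X) : measurable Q -> 0 < m Q ->
  {ae bernoulli_measure m, forall x : sequences X, exists j : nat, Q (x j)}.
Proof.
move=> mQ Q0; pose D := [set p : sequences X * X | Q p.2].
have mD : measurable D.
  have -> : D = setT `*` Q by apply/seteqP; split => p //= [].
  exact: measurableX.
have D0 : depends_on_prefix 0 D by [].
have := law_of_large_numbers m mD D0; apply: filterS => x.
have -> : xsection D x = Q.
  by apply/seteqP; split => z; rewrite /xsection/= inE.
move=> xD; apply: contrapT => nQ; move: xD.
under eq_fun => l.
  rewrite big1 ?mul0r; last first.
    move=> j _; rewrite indicE memNset// => Dj; apply: nQ.
    by exists (0 + j)%N.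
  over.
move=> /(cvg_unique (@Rhausdorff R)) /(_ (cvg_cst _)) Q00.
by move: Q0; rewrite -(@fineK _ (m Q)) ?fin_num_measure// Q00 ltxx.
Qed.

(** [Q l k] gathers the points whose section is close to [B l]. The sample visits every such set of
    positive measure and almost every y avoids the null ones, so some x_j shares with y a set
    [Q l k]; the triangle inequality through [B l] concludes. *)
Lemma ae_dense_sections : {ae bernoulli_measure m, forall x : sequences X, dense_sections x}.
Proof.
have [B [mB BE]] := separable_xsection m mE.
pose e k : R := (k.+1%:R^-1)%R.
have e0 k : (0 < e k)%R by rewrite invr_gt0.
pose Q l k := [set y | m (xsection E y `+` B l) < (e k)%:E].
have mQ l k : measurable (Q l k).
  have mD : measurable (E `+` (setT `*` B l)).
    by apply: measurable_setY => //; exact: measurableX.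
  have := emeasurable_fun_infty_o measurableT (measurable_fun_xsection m mD) (e k)%:E.
  rewrite setTI; congr (measurable _); apply/seteqP.
  have DE y : xsection (E `+` (setT `*` B l)) y = xsection E y `+` B l.
    by apply/seteqP; split => z; rewrite /xsection/setY/= !inE/=; tauto.
  by split => y /=; rewrite DE.
have hit l k : {ae bernoulli_measure m, forall x : sequences X,
    0 < m (Q l k) -> exists j, Q l k (x j)}.
  have [Q0|Q0] := pselect (0 < m (Q l k)); last by apply: aeW => x /Q0.
  by have := ae_hits (mQ l k) Q0; apply: filterS.
have := ae_foralln (fun l => ae_foralln (hit l)).
apply: filterS => x xH.
have : {ae m, forall y l k, m (Q l k) = 0 -> ~ Q l k y}.
  apply: ae_foralln => l; apply: ae_foralln => k.
  have [Q0|Q0] := eqVneq (m (Q l k)) 0; last by apply: aeW => y /eqP; rewrite (negbTE Q0).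
  by exists (Q l k); split => // y /= /not_implyP[_ /contrapT].
apply: filterS => y yQ r r0.
have [k kr] : exists k, (e k < r / 2)%R.
  have r20 : (0 < r / 2)%R by exact: divr_gt0.
  have [k _ /(_ k (leqnn k)) kr] := near_infty_natSinv_lt (PosNum r20).
  by exists k.
have [l yl] := BE y _ (e0 k).
have [j xj] : exists j, Q l k (x j).
  apply: xH; rewrite lt0e measure_ge0 andbT; apply/eqP => /yQ; exact.
exists j; apply: le_lt_trans (measure_setY_triangle m _ (mB l) _) _.
- exact: measurable_xsection.
- exact: measurable_xsection.
- rewrite (splitr r) EFinD lteD//; first by rewrite (lt_trans yl).
  by rewrite setYC (lt_trans xj).
Qed.

End good_sequences.

(** * Null sets in products and their sections *)

Section null_sections.
Context d1 d2 (T1 : measurableType d1) (T2 : measurableType d2) (R : realType).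
Variables (m1 : probability T1 R) (m2 : probability T2 R).

Lemma product_measure_xsection_eq0 (A : set (T1 * T2)) : measurable A ->
  (m1 \x m2) A = 0 <-> {ae m1, forall x, m2 (xsection A x) = 0}.
Proof.
move=> mA; have mf := measurable_fun_xsection m2 mA.
have [H1 H2] := ae_eq_integral_abs m1 measurableT mf.
have E : \int[m1]_x `|(m2 \o xsection A) x| = (m1 \x m2) A.
  by apply: eq_integral => x _; rewrite gee0_abs.
split => [A0|A0].
  by rewrite E in H1; apply: filterS (H1 A0) => x /(_ I).
by rewrite -E; apply: H2; apply: filterS A0 => x + _.
Qed.

Lemma product_measure_ysection_eq0 (A : set (T1 * T2)) : measurable A ->
  (m1 \x m2) A = 0 -> {ae m2, forall y, m1 (ysection A y) = 0}.
Proof.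
move=> mA.
have -> : (m1 \x m2) A = (m1 \x^ m2) A.
  by apply: product_measure_unique => // B C mB mC; exact: product_measure2E.
have mf := measurable_fun_ysection m1 mA.
have [H1 _] := ae_eq_integral_abs m2 measurableT mf.
have E : \int[m2]_x `|(m1 \o ysection A) x| = (m1 \x^ m2) A.
  by apply: eq_integral => x _; rewrite gee0_abs.
move=> A0; rewrite E in H1; apply: filterS (H1 A0) => x; exact.
Qed.

Lemma ae_product_sections (Q : T1 -> T2 -> Prop) :
  {ae (m1 \x m2), forall p, Q p.1 p.2} ->
  {ae m2, forall y, {ae m1, forall x, Q x y}}.
Proof.
move=> [N [mN N0 QN]]; apply: filterS (product_measure_ysection_eq0 mN N0) => y Ny.
exists (ysection N y); split => //; first exact: measurable_ysection.
by move=> x /= nQ; rewrite /ysection/= inE; exact: QN.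
Qed.

End null_sections.

Section good.
Context d (X : measurableType d) (R : realType) (m : probability X R).
Variable E : set (X * X).

(** The third clause makes the measures of the traces of E_y on pattern sets visible in the graph of
    the prolonged sample, see [pattern_set_scons]. *)
Definition good (x : sequences X) := [/\ typical m E x, dense_sections m E x &
  {ae m, forall y, typical m E (scons (y, x))}].

(** By [bernoulli_scons], [scons (y, x)] is again a Bernoulli sample when y is drawn independently
    of x; Fubini then turns [ae_typical] into the third clause. *)
Lemma ae_good : measurable E -> {ae bernoulli_measure m, forall x : sequences X, good x}.
Proof.
move=> mE; have aty := ae_typical m mE; have ad := ae_dense_sections m mE.
have : {ae bernoulli_measure m, forall x : sequences X,
    {ae m, forall y, typical m E (scons (y, x))}}.
  apply: ae_product_sections (fun y x => typical m E (scons (y, x))) _.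
  have [N [mN N0 tN]] := aty; exists (@scons d X @^-1` N); split.
  - by rewrite -[_ @^-1` _]setTI; exact: measurable_scons.
  - by rewrite -bernoulli_scons.
  - by move=> [y x]; exact: tN.
by apply: filterS3 aty ad => x ? ? ?; split.
Qed.

End good.

(** * Inner regularity with respect to a compact class *)

Section compact_classes.
Context d (T : measurableType d) (R : realType) (P : probability T R).
Variable lim : set_system T -> T.

(* An ultrafilter form of compact classes, which needs no topology on T; stability
   under finite unions and arbitrary intersections is immediate. *)
Definition captures (K : set T) := forall U, UltraFilter U -> U K -> K (lim U).

Definition inner_captured A := forall e : R, (0 < e)%R ->
  exists K, [/\ measurable K, K `<=` A, P (A `\` K) < e%:E & captures K].

Definition captured_regular := forall A, measurable A -> inner_captured A.

Lemma capturesU A B : captures A -> captures B -> captures (A `|` B).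
Proof.
move=> cA cB U UF; have [UA|UnA] := in_ultra_setVsetC A UF.
  by move=> _; left; exact: cA.
move=> UAB; right; apply: cB => //.
by apply: filterS (filterI UAB UnA) => x [[Ax|//] /(_ Ax)].
Qed.

Lemma captures_bigcap I (D : set I) (F : I -> set T) :
  (forall i, D i -> captures (F i)) -> captures (\bigcap_(i in D) F i).
Proof.
move=> cF U UF UI i Di; apply: (cF i Di) => //.
by apply: filterS UI => x; exact.
Qed.

Lemma capturesI A B : captures A -> captures B -> captures (A `&` B).
Proof.
move=> cA cB U UF UI; split; [apply: cA => //|apply: cB => //];
  by apply: filterS UI => x [].
Qed.

Lemma captures_bigcup_ord N (F : nat -> set T) :
  (forall i, (i < N)%N -> captures (F i)) -> captures (\bigcup_(i in `I_N) F i).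
Proof.
move=> cF; rewrite bigcup_mkord; elim: N cF => [|N IH] cF.
  by rewrite big_ord0 => U UF /filter_not_empty.
by rewrite big_ord_recr/=; apply: capturesU; [apply: IH => i iN|]; apply: cF => //; exact: ltnW.
Qed.

(** Captured sets are stable only under finite unions, so the union is first truncated at N and its
    tail is charged to the error. *)
Lemma inner_captured_bigcup (F : nat -> set T) :
  (forall n, measurable (F n)) -> (forall n, inner_captured (F n)) ->
  inner_captured (\bigcup_n F n).
Proof.
move=> mF iF e e0; have e20 : (0 < e / 2)%R by exact: divr_gt0.
have [N FN] := measure_bigcup_tail P mF (divr_gt0 e20 (ltr0n R 2)).
have ei i : (0 < e / 2 / 2 ^+ i.+2)%R by rewrite divr_gt0// exprn_gt0.
have /choice [K KP] i := iF i _ (ei i).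
have mK i : measurable (K i) by have [] := KP i.
have mKN : measurable (\bigcup_(i in `I_N) K i) by exact: bigcup_measurable.
have mFU : measurable (\bigcup_n F n) by exact: bigcupT_measurable.
exists (\bigcup_(i in `I_N) K i); split => //.
- by move=> x [i _ Kx]; exists i => //; have [_ + _ _] := KP i; apply.
- apply: (@le_lt_trans _ _ (e / 2)%:E); last by rewrite lte_fin gtr_pMr// invf_lt1// ltr1n.
  pose G n := if n is i.+1 then F i `\` K i else
    \bigcup_n F n `\` \bigcup_(i in `I_N) F i.
  apply: (le_measure_geometric_cover (F := G)).
  + exact: ltW.
  + exact: measurableD.
  + by case=> [|i]; apply: measurableD => //; exact: bigcup_measurable.
  + move=> x [Fx nK]; have [[i /= iN Fix]|nFx] :=
      pselect ((\bigcup_(i in `I_N) F i) x); last by exists 0%N.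
    by exists i.+1 => //; split => // Kx; apply: nK; exists i.
  + case=> [|i] /=; first by rewrite expr1; exact: ltW.
    by have [_ _ /ltW] := KP i.
- by apply: captures_bigcup_ord => i _; have [] := KP i.
Qed.

Lemma inner_captured_bigcap (F : nat -> set T) :
  (forall n, measurable (F n)) -> (forall n, inner_captured (F n)) ->
  inner_captured (\bigcap_n F n).
Proof.
move=> mF iF e e0; have e20 : (0 < e / 2)%R by exact: divr_gt0.
have ei i : (0 < e / 2 / 2 ^+ i.+1)%R by rewrite divr_gt0// exprn_gt0.
have /choice [K KP] i := iF i _ (ei i).
have mK i : measurable (K i) by have [] := KP i.
have mKI : measurable (\bigcap_i K i) by exact: bigcapT_measurable.
exists (\bigcap_i K i); split => //.
- by move=> x Kx i _; have [_ + _ _] := KP i; apply; exact: Kx.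
- apply: (@le_lt_trans _ _ (e / 2)%:E); last by rewrite lte_fin gtr_pMr// invf_lt1// ltr1n.
  apply: (le_measure_geometric_cover (F := fun i => F i `\` K i)).
  + exact: ltW.
  + by apply: measurableD => //; exact: bigcapT_measurable.
  + by move=> i; exact: measurableD.
  + by move=> x [Fx /existsNP[i /not_implyP[_ nK]]]; exists i => //; split => //; exact: Fx.
  + by move=> i; have [_ _ /ltW] := KP i.
- by apply: captures_bigcap => i _; have [] := KP i.
Qed.

(** The measurable sets that are inner captured together with their complement form a sigma-algebra;
    stability under countable unions uses both the union and the intersection lemma. *)
Lemma generated_captured_regular (G : set (set T)) : measurable = <<s G >> ->
  inner_captured setT ->
  (forall A, G A -> inner_captured A /\ inner_captured (~` A)) ->
  captured_regular.
Proof.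
move=> mG iT iG A; rewrite {1}mG => sA.
suff : <<s G >> `<=` [set A | [/\ measurable A, inner_captured A &
    inner_captured (~` A)]] by move=> /(_ _ sA) [].
apply: smallest_sub; last first.
  move=> B GB; have [? ?] := iG _ GB; split => //.
  by rewrite mG; exact: sub_sigma_algebra.
split.
- split => //; last by rewrite setC0.
  move=> e e0; exists set0; split => //; first by rewrite setD0 measure0 lte_fin.
  by move=> U UF /filter_not_empty.
- by move=> B [mB iB iCB]; rewrite setTD; split; rewrite ?setCK//; exact: measurableC.
- move=> F FP; have mF n : measurable (F n) by have [] := FP n.
  split; first exact: bigcupT_measurable.
    by apply: inner_captured_bigcup => // n; have [] := FP n.
  rewrite setC_bigcup; apply: inner_captured_bigcap => n; last by have [] := FP n.
  exact: measurableC.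
Qed.

(* In terms of the map w |-> (w \in F k)_k into the Cantor space, K behaves as a
   compact set on which the map is continuous: its image is closed. *)
Definition splits (F : nat -> set T) (K : set T) := [/\ measurable K, captures K &
  forall k, captures (K `&` F k) /\ captures (K `\` F k)].

(** A Lusin-type argument: for each k, A is replaced by a captured part inside [F k] and one outside
    it, at a loss e / 2 ^ k.+1, and K is the intersection over k. *)
Lemma regular_splits (F : nat -> set T) A (e : R) : captured_regular ->
  (forall k, measurable (F k)) -> measurable A -> (0 < e)%R ->
  exists K, [/\ splits F K, K `<=` A & P (A `\` K) <= e%:E].
Proof.
move=> reg mF mA e0.
have ek k : (0 < e / 2 ^+ k.+1 / 2)%R by rewrite !divr_gt0// exprn_gt0.
have /choice [K1 K1P] k := reg _ (measurableI _ _ mA (mF k)) _ (ek k).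
have /choice [K0 K0P] k := reg _ (measurableD mA (mF k)) _ (ek k).
pose K := \bigcap_k (K1 k `|` K0 k).
have mK : measurable K.
  apply: bigcapT_measurable => k; apply: measurableU.
    by have [] := K1P k.
  by have [] := K0P k.
have K1A k : K1 k `<=` A `&` F k by have [] := K1P k.
have K0A k : K0 k `<=` A `\` F k by have [] := K0P k.
have cK1 k : captures (K1 k) by have [] := K1P k.
have cK0 k : captures (K0 k) by have [] := K0P k.
have cK : captures K by apply: captures_bigcap => k _; exact: capturesU.
exists K; split.
- split => // k; split.
    have -> : K `&` F k = K `&` K1 k.
      apply/seteqP; split=> x [Kx Fx]; split => //.
        by case: (Kx k I) => // /K0A[].
      by have [] := K1A _ _ Fx.
    exact: capturesI.
  have -> : K `\` F k = K `&` K0 k.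
    apply/seteqP; split=> x [Kx Fx]; split => //.
      by case: (Kx k I) => // /K1A[].
    by have [] := K0A _ _ Fx.
  exact: capturesI.
- by move=> x /(_ 0%N I) [/K1A[]|/K0A[]].
- apply: (le_measure_geometric_cover
    (F := fun k => ((A `&` F k) `\` K1 k) `|` ((A `\` F k) `\` K0 k))).
  + exact: ltW.
  + exact: measurableD.
  + move=> k; have [mK1 _ _ _] := K1P k; have [mK0 _ _ _] := K0P k.
    by apply: measurableU; apply: measurableD => //;
      [exact: measurableI|exact: measurableD].
  + move=> x [Ax]; move=> /existsNP[k /not_implyP[_ /not_orP[n1 n0]]].
    by exists k => //; have [Fx|Fx] := pselect (F k x); [left|right].
  + move=> k; have [mK1 _ P1 _] := K1P k; have [mK0 _ P0 _] := K0P k.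
    apply: le_trans (measureU2 _ _ _) _.
    * by apply: measurableD => //; exact: measurableI.
    * by apply: measurableD => //; exact: measurableD.
    * by rewrite [leRHS](_ : _ = (e / 2 ^+ k.+1 / 2)%:E + (e / 2 ^+ k.+1 / 2)%:E);
        [rewrite leeD// ltW|rewrite -EFinD -splitr].
Qed.

(** Compactness: the nonempty decreasing sets [B n] lie in an ultrafilter U. Its limit is in K, and
    for each k on the side of [F k] prescribed by c, since both sides are captured. *)
Lemma splits_realize (F : nat -> set T) K (c : nat -> bool) : splits F K ->
  (forall n, exists w, K w /\ forall k, (k < n)%N -> (w \in F k) = c k) ->
  exists w, K w /\ forall k, (w \in F k) = c k.
Proof.
move=> [_ cK sK] real.
pose B n := [set w | K w /\ forall k, (k < n)%N -> (w \in F k) = c k].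
pose G : set_system T := [set S | exists n, B n `<=` S].
have BS m n : (m <= n)%N -> B n `<=` B m.
  by move=> mn w [Kw wn]; split => // k km; apply: wn; exact: leq_trans km mn.
have FG : ProperFilter G.
  split.
    by move=> [n Bn]; have [w] := real n; exact: Bn.
  split.
  - by exists 0%N.
  - move=> S S' [n nS] [n' nS']; exists (maxn n n') => w Bw; split.
      by apply: nS; apply: BS Bw; exact: leq_maxl.
    by apply: nS'; apply: BS Bw; exact: leq_maxr.
  - by move=> S S' SS' [n nS]; exists n; exact: subset_trans nS SS'.
have [U [UF GU]] := ultraFilterLemma FG.
have UK : U K by apply: GU; exists 0%N => w [].
exists (lim U); split; first exact: cK.
move=> k; have UB : U (B k.+1) by apply: GU; exists k.+1.
case ck: (c k).
  have [cF _] := sK k; apply/mem_set.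
  by have [] : (K `&` F k) (lim U);
    [apply: cF => //; apply: filterS UB => w [Kw /(_ k (ltnSn k))]; rewrite ck => /set_mem|].
have [_ cF] := sK k; apply: memNset.
by have [] : (K `\` F k) (lim U);
  [apply: cF => //; apply: filterS UB => w [Kw /(_ k (ltnSn k))]; rewrite ck => /negbT; rewrite notin_setE|].
Qed.

End compact_classes.

Lemma ultra_fmap T T' (f : T -> T') (U : set_system T) :
  UltraFilter U -> UltraFilter (f @ U).
Proof.
move=> UU; split; first exact: fmap_proper_filter.
move=> G GG UG; apply/seteqP; split => A; last exact: UG.
move=> GA; have [//|UnA] := in_ultra_setVsetC (f @^-1` A) UU.
have GnA : G (~` A) by exact: UG.
have : G (A `&` ~` A) by exact: filterI.
by rewrite setICr => /filter_not_empty.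
Qed.

(** * Compact classes on sequence spaces *)

Section sequence_regularity.
Context d (X : measurableType d) (R : realType) (m : probability X R).
Variable lim : set_system X -> X.

(** The coordinatewise limit, as in Tychonoff's theorem. *)
Definition sequences_lim (U : set_system (sequences X)) : sequences X :=
  fun i => lim ((fun x : sequences X => x i) @ U).

(** It suffices to treat coordinate events, whose complements are coordinate events too; one over a
    captured set is captured because ultrafilters push forward along the coordinate. *)
Lemma bernoulli_captured_regular : captured_regular m lim ->
  captured_regular (bernoulli_measure m) sequences_lim.
Proof.
move=> reg.
have coord i A : measurable A ->
    inner_captured (bernoulli_measure m) sequences_lim [set x | A (x i)].
  move=> mA e e0; have [K [mK KA PK cK]] := reg A mA e e0.
  have mc B : measurable B -> measurable [set x : sequences X | B (x i)].
    by move=> mB; have [n []] := cylinder_coord i mB.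
  exists [set x | K (x i)]; split.
  - exact: mc.
  - by move=> x; exact: KA.
  - by rewrite -(bernoulli_coord m i (measurableD mA mK)) in PK.
  - by move=> U UU UK; apply: cK => //; exact: ultra_fmap.
apply: (generated_captured_regular (G := @coordinate_events _ X)) => //.
  exact: (coord 0%N setT).
move=> _ [i _ [A mA <-]]; rewrite setTI; split; first exact: coord.
by apply: (coord i (~` A)); exact: measurableC.
Qed.

End sequence_regularity.

(** * Compact classes on Lebesgue spaces *)

Section lebesgue_spaces.
Context d (X : measurableType d) (R : realType) (m : probability X R).

Notation lambda := (@completed_lebesgue_measure R).
Notation hlength := (@wlength R idfun).
Notation lebesgue_measurable := (hlength^*)%mu.-cara.-measurable.

(** D is a Borel set up to a null set, and Borel sets are inner regular for compact sets. *)
Lemma completed_regularity_inner (D : set R) (e : R) :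
  lebesgue_measurable D -> lambda D < +oo -> (0 < e)%R ->
  exists V : set R, [/\ compact V, V `<=` D & lambda (D `\` V) < e%:E].
Proof.
rewrite -completed_caratheodory_measurable g_sigma_completed_algebra_genE.
move=> [A mA [N nN AND]] Doo e0.
have AD : A `<=` D by rewrite -AND; exact: subsetUl.
have Aoo : lebesgue_measure A < +oo.
  by apply: le_lt_trans Doo; exact: (le_outer_measure hlength^*%mu).
have [V [cV VA AV]] := lebesgue_regularity_inner mA Aoo e0.
exists V; split => //; first exact: subset_trans VA AD.
have [M [mM M0 NM]] := nN.
apply: le_lt_trans AV.
apply: (@le_trans _ _ (hlength^*%mu ((A `\` V) `|` M))).
  apply: le_outer_measure => x [Dx nVx]; move: Dx; rewrite -AND => -[Ax|Nx].
    by left.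
  by right; exact: NM.
apply: le_trans (outer_measureU2 _ _ _) _.
by rewrite [X in _ + X](_ : _ = 0) ?adde0.
Qed.

(** Without atoms the space is mod 0 an interval, and compact sets of reals pull back along the
    isomorphism f to captured sets. *)
Lemma lebesgue_space_captured_regular : lebesgue_space m -> atomless (R := R) m ->
  exists lim, captured_regular m lim.
Proof.
move=> [_ [S [a [_ atoms _ [X0 [Y0 [f [[mX0 _ mSX0] [mY0 _ _] [fXY finj _] fm fmu]]]]]]]] na.
(* A point of S would give an atom, since the only subsets of a singleton are itself and the empty
   set. *)
have S0 : S = set0.
  apply/seteqP; split => // x /atoms [mx x0]; apply: na.
  exists [set x]; split => // B mB Bx.
  have [Bx'|nBx] := pselect (B x); [right|left].
    by congr (m _); apply/seteqP; split => // _ ->.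
  suff -> : B = set0 by rewrite measure0.
  by apply/seteqP; split => // z Bz; apply: nBx; rewrite -(Bx z Bz).
rewrite S0 setC0 in mSX0.
(* The limit of U is the point of X0 that f sends to the limit of the image of U, a default value if
   there is none. *)
pose limP (U : set_system X) x := X0 x /\ (f @ U) --> f x.
exists (fun U => get (limP U)) => A mA e e0.
have mAX0 : measurable (A `&` X0) by exact: measurableI.
have AX0 : A `&` X0 `<=` X0 by move=> x [].
have mfA := (fm _ AX0).1 mAX0.
have fAoo : lambda (f @` (A `&` X0)) < +oo.
  rewrite -fmu//; exact: le_lt_trans (probability_le1 _ _) (ltry _).
have [V [cV VA lV]] := completed_regularity_inner mfA fAoo e0.
pose K := X0 `&` f @^-1` V.
have KX0 : K `<=` X0 by move=> x [].
have fK : f @` K = V.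
  apply/seteqP; split => [_ [x [_ Vx] <-] //|y Vy].
  by have [x [Ax X0x] fxy] := VA y Vy; exists x => //; split => //; rewrite /preimage/= fxy.
have KA : K `<=` A.
  move=> x [X0x Vx]; have [z [Az X0z] fzx] := VA _ Vx.
  by rewrite -(finj z x) ?inE.
have mK : measurable K.
  apply/(fm _ KX0); rewrite fK; apply: sub_caratheodory.
  exact: compact_measurable.
exists K; split => //.
- apply: (@le_lt_trans _ _ (m (~` X0) + m ((A `&` X0) `\` K))).
    apply: le_trans (measureU2 _ _ _); [|exact: measurableC|exact: measurableD].
    apply: le_measure; rewrite ?inE.
    + exact: measurableD.
    + by apply: measurableU; [exact: measurableC|exact: measurableD].
    + move=> x [Ax nK]; have [X0x|] := pselect (X0 x); last by left.

      by right.
  have -> : m (~` X0) = 0 by rewrite -setTD.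
  rewrite add0e fmu; last 2 first.
  + by move=> x [[]].
  + exact: measurableD.
  apply: le_lt_trans lV; apply: le_outer_measure => _ [x [[Ax X0x] nK] <-].
  by split; [exists x|move=> Vx; apply: nK].
- move=> U UU UK.
  have UfV : (f @ U) V by have : K `<=` f @^-1` V by [move=> x []]; move=> /filterS; exact.
  have : UltraFilter (f @ U) by exact: ultra_fmap.
  move: cV; rewrite compact_ultra => /(_ _ _ UfV) H /H [y [Vy Uy]].
  move: Vy Uy; rewrite -fK => -[x Kx <-] Ux.
  have : limP U (get (limP U)).
    by apply: getPex; exists x; split => //; exact: KX0.
  set z := get _ => -[X0z Uz].
  have /finj <- : f x = f z by exact: (cvg_unique _ Ux Uz).
  - by [].
  - by rewrite inE; exact: KX0.
  - by rewrite inE.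
Qed.

End lebesgue_spaces.

(** * Samples with a common graph *)

Lemma measurable_edge d (X : measurableType d) (E : set (X * X)) ij :
  measurable E -> measurable [set x : sequences X | induced_graph E x ij].
Proof.
case: ij => i j mE; rewrite /induced_graph/=; case: eqP => [_|_] /=.
  by rewrite (_ : [set _ | false] = set0)//; apply/seteqP; split.
have mf : measurable_fun setT (fun x : sequences X => (x i, x j)).
  by apply: measurable_fun_pair; exact: measurable_coord.
have := mf measurableT _ mE; rewrite setTI; congr (measurable _).
by apply/seteqP; split => x /=; rewrite inE.
Qed.

Lemma measurable_matrix_entry ij : measurable [set g : adjacency_matrix | g ij].
Proof.
apply: sub_sigma_algebra => /=.
have -> : [set g : adjacency_matrix | g ij] =
    (fun g : {ptws nat * nat -> bool} => g ij) @^-1` [set true].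
  by apply/seteqP; split => g.
apply: open_comp => [g _|]; first exact: (@proj_continuous _ (fun=> bool) ij g).
exact: discrete_open.
Qed.

(** The set of graphs of good samples need not be measurable. It is replaced by G, the closed set of
    graphs whose every finite part occurs in a compact-like set K of good samples. Equality of laws
    gives G positive probability under E, and [splits_realize] turns a graph in G into the graph of
    a point of K. *)
Lemma exists_common_graph d d' (X : measurableType d) (X' : measurableType d')
    (R : realType) (m : probability X R) (m' : probability X' R)
    (E : set (X * X)) (E' : set (X' * X')) (lim : set_system X' -> X')
    (A : set (sequences X)) (A' : set (sequences X')) :
  measurable E -> measurable E' -> captured_regular m' lim ->
  (forall B : set adjacency_matrix, measurable B ->
    graph_law m E B = graph_law m' E' B) ->
  {ae bernoulli_measure m, forall x : sequences X, A x} ->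
  {ae bernoulli_measure m', forall x : sequences X', A' x} ->
  exists x x', [/\ A x, A' x' & induced_graph E x = induced_graph E' x'].
Proof.
move=> mE mE' reg law [N [mN N0 AN]] [N' [mN' N'0 AN']].
pose p k : nat * nat := odflt (0%N, 0%N) (unpickle k).
pose F k := [set x | induced_graph E' x (p k)].
have mF k : measurable (F k) by exact: measurable_edge.
(* Any constant below 1 would do: it serves to leave K of positive measure. *)
have half : (0 < 1 / 2 :> R)%R by rewrite divr_gt0.
have [K [sK KN' PK]] := regular_splits (bernoulli_captured_regular reg) mF
  (measurableC mN') half.
have mK : measurable K by have [] := sK.
(* The words of the first n matrix entries, in the enumeration p, that occur in K. *)
pose B n := [set s : seq bool | exists w, K w /\
  forall k, (k < n)%N -> (w \in F k) = nth false s k].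
pose G := \bigcap_n [set g : adjacency_matrix | B n (mkseq (fun k => g (p k)) n)].
have mG : measurable G.
  apply: bigcapT_measurable => n.
  exact: (measurable_pattern n (B n) (fun k => measurable_matrix_entry (p k))).
have mGE d0 (Y : measurableType d0) (D : set (Y * Y)) : measurable D ->
    measurable (induced_graph D @^-1` G).
  move=> mD; rewrite preimage_bigcap; apply: bigcapT_measurable => n.
  exact: (measurable_pattern n (B n) (fun k => measurable_edge (p k) mD)).
have KG : K `<=` induced_graph E' @^-1` G.
  move=> w Kw n _; exists w; split => // k kn; rewrite nth_mkseq//.
  by apply/idP/idP; rewrite inE.
have K0 : 0 < bernoulli_measure m' K.
  rewrite lt0e measure_ge0 andbT; apply/eqP => K0.
  have : bernoulli_measure m' (~` N') <=
      bernoulli_measure m' (~` N' `\` K) + bernoulli_measure m' K.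
    apply: le_trans (measureU2 _ _ _) => //; last first.
      by apply: measurableD => //; exact: measurableC.
    apply: le_measure; rewrite ?inE; first exact: measurableC.
      by apply: measurableU => //; apply: measurableD => //; exact: measurableC.
    by move=> w Nw; have [Kw|Kw] := pselect (K w); [right|left].
  have -> : bernoulli_measure m' (~` N') = 1.
    transitivity (1 - bernoulli_measure m' N'); first exact: probability_setC.
    by rewrite N'0 sube0.
  rewrite K0 adde0 => /le_trans /(_ PK).
  by rewrite lee_fin leNgt ltr_pdivrMr// mul1r ltr1n.
have [x [Gx Nx]] : exists x, (induced_graph E @^-1` G) x /\ ~ N x.
  apply: contrapT => /forallNP nx.
  have : bernoulli_measure m (induced_graph E @^-1` G) <= bernoulli_measure m N.
    apply: le_measure; rewrite ?inE//; first exact: mGE.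
    by move=> x Gx; apply: contrapT => Nx; exact: (nx x).
  rewrite N0 leNgt => /negP; apply.
  have -> : bernoulli_measure m (induced_graph E @^-1` G) =
      bernoulli_measure m' (induced_graph E' @^-1` G) by exact: law.
  by apply: lt_le_trans K0 _; apply: le_measure; rewrite ?inE//; exact: mGE.
have [|w [Kw wE]] := splits_realize (c := fun k => induced_graph E x (p k)) sK.
  move=> n; have [w [Kw wn]] := Gx n I; exists w; split => // k kn.
  by rewrite wn// nth_mkseq.
exists x, w; split.
- by apply: contrapT => /AN.
- by apply: contrapT => /AN' /(KN' _ Kw).
- apply/funext => ij; have pij : p (pickle ij) = ij by rewrite /p pickleK.
  have := wE (pickle ij); rewrite /F pij => <-.
  by apply/idP/idP; rewrite inE.
Qed.

(** * Transport along a common graph *)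

Section common_graph.
Context d d' (X : measurableType d) (X' : measurableType d') (R : realType).
Variables (m : probability X R) (m' : probability X' R).
Variables (E : set (X * X)) (E' : set (X' * X')).
Hypotheses (mE : measurable E) (mE' : measurable E').
Hypotheses (symE : forall x y, E (x, y) -> E (y, x))
  (symE' : forall x y, E' (x, y) -> E' (y, x)).
Variables (x : sequences X) (x' : sequences X').
Hypothesis graph_eq : induced_graph E x = induced_graph E' x'.

Definition same_type y y' := forall k, ((x k, y) \in E) = ((x' k, y') \in E').

Lemma pattern_eqP n y y' : pattern E x n y = pattern E' x' n y' <->
  forall k, (k < n)%N -> ((x k, y) \in E) = ((x' k, y') \in E').
Proof.
split => [H k kn|H]; first by have := congr1 (nth false ^~ k) H; rewrite /= !nth_mkseq.
by apply/eq_in_map => k; rewrite mem_iota add0n => /= kn; exact: H.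
Qed.

(** Both are limits of the same frequencies, those of the common graph. *)
Lemma typical_measure_eq n B : typical m E x -> typical m' E' x' ->
  m (pattern_set E x n B) = m' (pattern_set E' x' n B).
Proof.
move=> /(_ n B) tx /(_ n B) tx'; rewrite graph_eq in tx.
have := cvg_unique (@Rhausdorff R) tx tx' => H.
rewrite -(@fineK _ (m _)) ?H ?fineK// fin_num_measure//;
  exact: measurable_pattern_set.
Qed.

Lemma induced_graph_scons y y' : same_type y y' ->
  induced_graph E (scons (y, x)) = induced_graph E' (scons (y', x')).
Proof.
have inC (Z : Type) (D : set (Z * Z)) a b : (forall a b, D (a, b) -> D (b, a)) ->
    ((a, b) \in D) = ((b, a) \in D).
  by move=> symD; apply/idP/idP; rewrite !inE; exact: symD.
move=> yy'; apply/funext => -[[|i] [|j]] //=; rewrite /induced_graph/=.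
- by rewrite inC// yy' inC.
- exact: yy'.
- have := congr1 (fun g => g (i, j)) graph_eq.
  by rewrite /induced_graph/= eqSS.
Qed.

End common_graph.

Lemma pattern_scons d0 (Y : measurableType d0) (D : set (Y * Y)) (u : sequences Y) n y z :
  pattern D (scons (y, u)) n.+1 z = ((y, z) \in D) :: pattern D u n z.
Proof. by rewrite /pattern /mkseq /= -[1%N]addn0 iotaDl -map_comp. Qed.

(** Once y is prepended, adjacency to y is the first letter of each pattern, so traces of E_y become
    pattern sets of the prolonged sample. *)
Lemma pattern_set_scons d0 (Y : measurableType d0) (D : set (Y * Y)) (u : sequences Y) n B y :
  pattern_set D (scons (y, u)) n.+1 [set s | head false s /\ B (behead s)] =
  xsection D y `&` pattern_set D u n B.
Proof.
apply/seteqP; split => z; rewrite /pattern_set /preimage /mkset pattern_scons.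
  by [].
by [].
Qed.

Lemma section_pattern_set d0 (Y : measurableType d0) (D : set (Y * Y)) (u : sequences Y) k :
  xsection D (u k) = pattern_set D u k.+1 [set s | nth false s k].
Proof.
by apply/seteqP; split => z; rewrite /pattern_set /preimage/= nth_mkseq.
Qed.

Section section_measures.
Context d d' (X : measurableType d) (X' : measurableType d') (R : realType).
Variables (m : probability X R) (m' : probability X' R).
Variables (E : set (X * X)) (E' : set (X' * X')).
Hypotheses (mE : measurable E) (mE' : measurable E').
Hypotheses (symE : forall x y, E (x, y) -> E (y, x))
  (symE' : forall x y, E' (x, y) -> E' (y, x)).
Variables (x : sequences X) (x' : sequences X').
Hypothesis graph_eq : induced_graph E x = induced_graph E' x'.

Lemma section_measure_eq n B y y' : same_type E E' x x' y y' ->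
  typical m E (scons (y, x)) -> typical m' E' (scons (y', x')) ->
  m (xsection E y `&` pattern_set E x n B) =
  m' (xsection E' y' `&` pattern_set E' x' n B).
Proof.
move=> yy' ty ty'; rewrite -!pattern_set_scons.
by apply: typical_measure_eq => //; exact: induced_graph_scons.
Qed.

Lemma section_measureT y y' : same_type E E' x x' y y' ->
  typical m E (scons (y, x)) -> typical m' E' (scons (y', x')) ->
  m (xsection E y) = m' (xsection E' y').
Proof.
move=> yy' ty ty'; have := section_measure_eq 0 setT yy' ty ty'.
by rewrite /pattern_set !preimage_setT !setIT.
Qed.

Lemma section_measureI k y y' : same_type E E' x x' y y' ->
  typical m E (scons (y, x)) -> typical m' E' (scons (y', x')) ->
  m (xsection E y `&` xsection E (x k)) =
  m' (xsection E' y' `&` xsection E' (x' k)).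
Proof. by move=> *; rewrite !section_pattern_set; exact: section_measure_eq. Qed.

End section_measures.

(** * Injectivity of types from purity *)

Section separation.
Context d (X : measurableType d) (R : realType) (m : probability X R).
Variable E : set (X * X).
Hypotheses (mE : measurable E) (symE : forall x y, E (x, y) -> E (y, x)).
Variable x : sequences X.

(** Comparing the graph with itself, the two sections have equal measure and equal traces on every
    E_(x_k); since these come close to E_y, [measure_setY_eq0] applies. *)
Lemma same_type_section y z : same_type E E x x y z ->
  typical m E (scons (y, x)) -> typical m E (scons (z, x)) ->
  (forall e : R, (0 < e)%R ->
    exists k, m (xsection E y `+` xsection E (x k)) < e%:E) ->
  m (xsection E y `+` xsection E z) = 0.
Proof.
move=> yz ty tz dy.
apply: measure_setY_eq0; [exact: measurable_xsection..| |].
  exact: (section_measureT mE mE symE symE erefl).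
move=> e /dy [k yk]; exists (xsection E (x k)); split => //.
  exact: measurable_xsection.
exact: (section_measureI mE mE symE symE erefl).
Qed.

Lemma pure_types : pure m E -> good m E x ->
  exists X1, [/\ measurable X1, m X1 = 1,
    (forall y, X1 y -> typical m E (scons (y, x))) &
    forall y z, X1 y -> X1 z -> same_type E E x x y z -> y = z].
Proof.
move=> [X0 [mX0 X01 inj]] [_ [N [mN N0 dN]] [N' [mN' N'0 tN']]].
have tX1 y : (~` N') y -> typical m E (scons (y, x)).
  by move=> N'y; apply: contrapT => /tN'.
exists (X0 `&` ~` (N `|` N')); have mNN : measurable (N `|` N') by exact: measurableU.
split.
- by apply: measurableI => //; exact: measurableC.
- rewrite probability_setI1 ?X01//; first exact: measurableC.
  by rewrite probability_setC// null_set_setU// sube0.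
- by move=> y [_]; rewrite setCU => -[_ /tX1].
- move=> y z [X0y]; rewrite setCU => -[Ny N'y] [X0z [Nz N'z]] yz.
  apply: inj => //; apply: same_type_section => //; [exact: tX1|exact: tX1|].
  by apply: contrapT => /dN.
Qed.

End separation.

(** * The type-preserving map and its properties *)

Section transport.
Context d d' (X : measurableType d) (X' : measurableType d') (R : realType).
Variables (m : probability X R) (m' : probability X' R).
Variables (E : set (X * X)) (E' : set (X' * X')).
Hypotheses (mE : measurable E) (mE' : measurable E').
Hypotheses (symE : forall x y, E (x, y) -> E (y, x))
  (symE' : forall x y, E' (x, y) -> E' (y, x)).
Variables (x : sequences X) (x' : sequences X').
Hypothesis graph_eq : induced_graph E x = induced_graph E' x'.
Hypotheses (gx : good m E x) (gx' : good m' E' x').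
Variable lim : set_system X' -> X'.
Hypothesis regular : captured_regular m' lim.
Hypothesis complete : measure_is_complete m.
Variable X1 : set X'.
Hypotheses (mX1 : measurable X1) (X11 : m' X1 = 1).
Hypothesis X1_inj : forall y z, X1 y -> X1 z -> same_type E' E' x' x' y z -> y = z.
Hypothesis X1_typical : forall y, X1 y -> typical m' E' (scons (y, x')).

Let F k := xsection E' (x' k).

Let mF k : measurable (F k).
Proof. exact: measurable_xsection. Qed.

(** The points of X whose type is in the closure of the set of types of K. Being cut out by finite
    patterns, it is measurable. *)
Definition shadow (K : set X') : set X := \bigcap_n pattern_set E x n
  [set s | exists2 w, K w & pattern E' x' n w = s].

Lemma measurable_shadow K : measurable (shadow K).
Proof. by apply: bigcapT_measurable => n; exact: measurable_pattern_set. Qed.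

(** The stages decrease to the shadow, and each has the measure of its counterpart in X', which
    contains K. *)
Lemma le_measure_shadow K : measurable K -> m' K <= m (shadow K).
Proof.
move=> mK; pose B n := [set s | exists2 w, K w & pattern E' x' n w = s].
have mB n : measurable (pattern_set E x n (B n)) by exact: measurable_pattern_set.
have : m \o (fun n => pattern_set E x n (B n)) @ \oo -->
    m (\bigcap_n pattern_set E x n (B n)).
  apply: nonincreasing_cvg_mu => //; last 2 first.
  - exact: bigcapT_measurable.
  - apply/nonincreasing_seqP => n; apply/subsetPset => y [w Kw wy].
    exists w => //; apply/esym/pattern_eqP => k kn.
    by move/esym/pattern_eqP: wy; apply; exact: ltnW.
  - by rewrite (le_lt_trans (probability_le1 m (mB 0%N)))// ltry.
move=> cvgB; rewrite /shadow -(cvg_lim (@ereal_hausdorff R) cvgB).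
apply: lime_ge; first by apply/cvg_ex; eexists; exact: cvgB.
apply: nearW => n /=; have [tx _ _] := gx; have [tx' _ _] := gx'.
rewrite (typical_measure_eq mE mE' graph_eq n (B n) tx tx').
apply: le_measure; rewrite ?inE//; first exact: measurable_pattern_set.
by move=> w Kw; exists w.
Qed.

Lemma shadow_same_type K y : splits lim F K -> shadow K y ->
  exists2 w, K w & same_type E E' x x' y w.
Proof.
move=> sK Ky; have [|w [Kw wy]] := splits_realize (c := fun k => (x k, y) \in E) sK.
  move=> n; have [w Kw wy] := Ky n I; exists w; split => // k kn.
  by move/esym/pattern_eqP: wy => ->//; rewrite mem_xsection.
by exists w => // k; rewrite -wy mem_xsection.
Qed.

(* Junk when no point of X1 has the type of y, which happens only on a null set. *)
Definition transport y := get [set w | X1 w /\ same_type E E' x x' y w].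

(** W is a union of shadows of sets that fill B within X1 up to arbitrarily small measure and are
    compact enough for each shadow point to have a partner of its type. *)
Lemma transport_sub (B : set X') : measurable B -> exists W, [/\ measurable W,
  m' B <= m W & forall y, W y ->
  [/\ B (transport y), X1 (transport y) & same_type E E' x x' y (transport y)]].
Proof.
move=> mB; have mBX : measurable (B `&` X1) by exact: measurableI.
have /choice [K KP] k : exists K, [/\ splits lim F K, K `<=` B `&` X1 &
    m' ((B `&` X1) `\` K) <= ((k.+1%:R^-1)%R)%:E].
  by apply: regular_splits => //; rewrite invr_gt0.
have mK k : measurable (K k) by have [[]] := KP k.
exists (\bigcup_k shadow (K k)); split.
- by apply: bigcupT_measurable => k; exact: measurable_shadow.
- apply/lee_addgt0Pr => e e0.
  have [k _ /(_ k (leqnn k)) ke] := near_infty_natSinv_lt (PosNum e0).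
  have BX : m' B = m' (B `&` X1).
    by rewrite probability_setI1.
  have [_ KB BK] := KP k.
  rewrite BX (measureDI m' mBX (mK k)) addeC leeD//; last first.
    by apply: le_trans BK _; rewrite lee_fin ltW.
  rewrite setIidr//; apply: le_trans (le_measure_shadow (mK k)) _.
  apply: le_measure; rewrite ?inE; first exact: measurable_shadow.
    by apply: bigcupT_measurable => i; exact: measurable_shadow.
  by move=> y Ky; exists k.
- move=> y [k _ Ky]; have [sK KB _] := KP k.
  have [w Kw yw] := shadow_same_type sK Ky; have [Bw X1w] := KB _ Kw.
  have [X1T yT] : X1 (transport y) /\ same_type E E' x x' y (transport y).
    by apply: (@getPex _ [set w | X1 w /\ same_type E E' x x' y w]); exists w.
  (* Both points have the type of y, hence the same type, and lie in X1. *)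
  suff -> : transport y = w by [].
  by apply: X1_inj => // i; rewrite -yT.
Qed.

(* The preimage of B lies between W, of measure at least m' B, and the complement
   of a V of measure at least m' (~` B); completeness of m does the rest. *)
Lemma transport_measure (B : set X') : measurable B ->
  measurable (transport @^-1` B) /\ m (transport @^-1` B) = m' B.
Proof.
move=> mB; have [W [mW BW WP]] := transport_sub mB.
have [V [mV BV VP]] := transport_sub (measurableC mB).
have WT : W `<=` transport @^-1` B by move=> y /WP[].
have TW : transport @^-1` B `\` W `<=` ~` (W `|` V).
  by move=> y [By nW] [//|/VP[nB]]; case: nB.
have mWV : measurable (W `|` V) by exact: measurableU.
have WV0 : W `&` V = set0.
  by apply/seteqP; split => y // [/WP[By _ _] /VP[nBy _ _]].
have WV1 : m (W `|` V) = 1.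
  apply/eqP; rewrite eq_le probability_le1//= measureU//.
  apply: le_trans (leeD BW BV); rewrite probability_setC// addeC subeK//.
  by rewrite fin_num_measure.
have nWV0 : m (~` (W `|` V)) = 0 by rewrite probability_setC// WV1 subee.
have nD : m.-negligible (transport @^-1` B `\` W).
  by exists (~` (W `|` V)); split => //; exact: measurableC.
have mD := complete nD.
have TE : transport @^-1` B = W `|` (transport @^-1` B `\` W) by rewrite setDUK.
have mT : measurable (transport @^-1` B) by rewrite TE; exact: measurableU.
split => //; have D0 : m (transport @^-1` B `\` W) = 0 by apply/negligibleP.
have -> : m (transport @^-1` B) = m W + m (transport @^-1` B `\` W).
  by rewrite [in LHS]TE measureU// setDIK.
rewrite D0 adde0; apply/eqP; rewrite eq_le BW andbT.
have : m W + m V <= 1 by rewrite -measureU// probability_le1.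
rewrite -leeBrDr ?fin_num_measure// => /le_trans; apply.
rewrite leeBlDr ?fin_num_measure//.
by apply: le_trans (leeD2l _ BV); rewrite probability_setC// addeC subeK// fin_num_measure.
Qed.

Lemma measurable_transport : measurable_fun setT transport.
Proof. by move=> _ B mB; rewrite setTI; have [] := transport_measure mB. Qed.

(** As in [same_type_section], with the second section pulled back by a measure-preserving map. The
    pullback of E'_(x'_k) agrees with E_(x_k) on the full-measure set W where types are
    preserved. *)
Lemma transport_section y : typical m E (scons (y, x)) ->
  X1 (transport y) -> same_type E E' x x' y (transport y) ->
  (forall e : R, (0 < e)%R ->
    exists k, m (xsection E y `+` xsection E (x k)) < e%:E) ->
  m (xsection E y `+` transport @^-1` xsection E' (transport y)) = 0.
Proof.
move=> ty X1T yT dy; have ty' := X1_typical X1T.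
have mEy : measurable (xsection E' (transport y)) by exact: measurable_xsection.
have mT B : measurable B -> measurable (transport @^-1` B).
  by move=> /transport_measure[].
have mTE B : measurable B -> m (transport @^-1` B) = m' B.
  by move=> /transport_measure[].
apply: measure_setY_eq0; [exact: measurable_xsection|exact: mT| |].
  rewrite mTE//; exact: (section_measureT mE mE' symE symE' graph_eq).
move=> e /dy [k yk]; have mxk : measurable (xsection E (x k)).
  exact: measurable_xsection.
exists (xsection E (x k)); split => //.
rewrite (section_measureI mE mE' symE symE' graph_eq k yT ty ty').
have mxk' : measurable (xsection E' (x' k)) by exact: measurable_xsection.
rewrite -mTE; last exact: measurableI.
have [W [mW W1 WP]] := transport_sub measurableT.
have {}W1 : m W = 1.
  by apply/eqP; rewrite eq_le probability_le1//= -(probability_setT m').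
rewrite -(@probability_setI1 _ _ _ m _ W)//; last exact/mT/measurableI.
rewrite -[RHS](@probability_setI1 _ _ _ m _ W)//; last first.
  by apply: measurableI => //; exact: mT.
congr (m _); apply/seteqP; split => z [[Tz zk] Wz]; split => //; split => //.
  have [_ _ zT] := WP _ Wz; have := zT k.
  by rewrite -!mem_xsection (mem_set zk) => /set_mem.
have [_ _ zT] := WP _ Wz; have := zT k.
by rewrite -!mem_xsection (mem_set zk) => /esym/set_mem.
Qed.

(** By Fubini the exceptional set is null as soon as almost all its sections are, which is
    [transport_section]. *)
Lemma transport_iso : measurable_graph_iso m E m' E'.
Proof.
exists transport; split; first exact: measurable_transport.
  by move=> B /transport_measure[].
pose TT (p : X * X) := (transport p.1, transport p.2).
have mTT : measurable (TT @^-1` E').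
  rewrite -[X in measurable X]setTI.
  have : measurable_fun setT TT; last exact.
  by apply: measurable_fun_pair; apply: (measurableT_comp measurable_transport).
have mD : measurable (E `+` TT @^-1` E') by exact: measurable_setY.
exists (E `+` TT @^-1` E'); split => //; last first.
  move=> p /= nE; apply: contrapT => nD; apply: nE.
  by split => ?; apply: contrapT => ?; apply: nD; [left|right].
apply/product_measure_xsection_eq0 => //.
have [W [mW W1 WP]] := transport_sub measurableT.
have aW : {ae m, forall y, W y}.
  exists (~` W); split => //; first exact: measurableC.
  have {}W1 : m W = 1.
    by apply/eqP; rewrite eq_le probability_le1//= -(probability_setT m').
  by rewrite probability_setC// W1 subee.
have [_ dx tx] := gx.
apply: filterS3 aW dx tx => y Wy dy ty; have [_ X1T yT] := WP _ Wy.
rewrite -(transport_section ty X1T yT dy); congr (m _).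
by apply/seteqP; split => z; rewrite /xsection /setY /preimage/= !inE/= /TT/=; tauto.
Qed.

End transport.

(** * Isomorphic graphs have the same law *)

Section graph_measurability.

Let p k : nat * nat := odflt (0%N, 0%N) (unpickle k).

(** Otherwise matrices outside O agreeing with g on ever longer prefixes would converge to g
    pointwise. Hence an open set is a countable union of conditions on finitely many entries. *)
Lemma open_matrix_prefix (O : set {ptws nat * nat -> bool}) g : open O -> O g ->
  exists n, forall h, mkseq (h \o p) n = mkseq (g \o p) n -> O h.
Proof.
move=> oO Og; apply: contrapT => /forallNP nO.
have /choice [h hP] n : exists h : nat * nat -> bool,
    mkseq (h \o p) n = mkseq (g \o p) n /\ ~ O h.
  by have /existsNP[h /not_implyP[]] := nO n; exists h.
have : {ptws, h @ \oo --> (g : {ptws nat * nat -> bool})}.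
  apply/pointwise_cvgP => t; apply: cvg_near_cst.
  exists (pickle t).+1 => // n /= tn; have [hg _] := hP n.
  have := congr1 (nth false ^~ (pickle t)) hg.
  by rewrite /= !nth_mkseq//= /p pickleK.
move=> /(_ O) H; have : nbhs (h @ \oo) O by apply: H; exact: open_nbhs_nbhs.
by move=> [n _ /(_ n (leqnn n))]; have [_] := hP n.
Qed.

Lemma measurable_induced_graph d (X : measurableType d) (E : set (X * X)) :
  measurable E -> measurable_fun setT (induced_graph E).
Proof.
move=> mE; apply: (@measurability _ _ _ adjacency_matrix setT _
  (@open {ptws nat * nat -> bool})); first by [].
move=> _ [ O oO <-]; rewrite setTI.
have -> : induced_graph E @^-1` O = \bigcup_n [set x |
    [set s | forall h, mkseq (h \o p) n = s -> O h]
      (mkseq (fun k => induced_graph E x (p k)) n)].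
  apply/seteqP; split => x; first by move=> /(open_matrix_prefix oO)[n]; exists n.
  by move=> [n _]; apply.
apply: bigcupT_measurable => n.
exact: (measurable_pattern n _ (fun k => measurable_edge (p k) mE)).
Qed.

End graph_measurability.

Section law_invariance.
Context d d' (X : measurableType d) (X' : measurableType d') (R : realType).
Variables (m : probability X R) (m' : probability X' R) (T : X -> X').
Hypotheses (mT : measurable_fun setT T)
  (mTE : forall A, measurable A -> m (T @^-1` A) = m' A).

Definition map_seq (x : sequences X) : sequences X' := fun i => T (x i).

Lemma measurable_map_seq : measurable_fun setT map_seq.
Proof.
by apply: measurable_fun_seq => i; exact: (measurableT_comp mT (measurable_coord i)).
Qed.

Lemma measurable_map_seq_preimage A : measurable A -> measurable (map_seq @^-1` A).
Proof. by move=> mA; rewrite -[_ @^-1` _]setTI; exact: measurable_map_seq. Qed.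

(** Induction on n: the remaining coordinates are transported by the induction hypothesis under the
    integral, the first one by change of variables. *)
Lemma bernoulli_map_cyl n A : cyl n A ->
  bernoulli_measure m (map_seq @^-1` A) = bernoulli_measure m' A.
Proof.
elim: n A => [|n IH] A cA.
  have [[x Ax]|A0] := pselect (A !=set0).
    have -> : A = setT by rewrite -subTset => y _; apply: (cA.2 x).
    by rewrite preimage_setT !probability_setT.
  have -> : A = set0 by apply/seteqP; split=> // x Ax; apply: A0; exists x.
  by rewrite preimage_set0 !measure0.
rewrite bernoulli_scons; last by apply: measurable_map_seq_preimage; exact: cA.1.
rewrite bernoulli_scons; last exact: cA.1.
rewrite /product_measure1.
transitivity (\int[m]_y bernoulli_measure m' (section0 (T y) A)).
  apply: eq_integral => y _ /=; rewrite -IH; last exact: cyl_section0.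
  congr (bernoulli_measure m _); rewrite xsectionE.
  apply/seteqP; split => z; rewrite /preimage /section0/=;
    by congr (A _); apply/funext => -[].
have mf : measurable_fun setT (fun y => bernoulli_measure m' (section0 y A)).
  have mB : measurable (@scons d' X' @^-1` A).
    by rewrite -[_ @^-1` _]setTI; exact: (measurable_scons _ cA.1).
  have := measurable_fun_xsection (bernoulli_measure m') mB.
  apply: eq_measurable_fun => y _ /=.
  by congr (bernoulli_measure m' _); rewrite xsectionE.
have := ge0_integral_pushforward mT m measurableT mf (fun y _ => measure_ge0 _ _).
rewrite preimage_setT => <-.
rewrite (eq_measure_integral m'); last by move=> B mB _; exact: mTE.
by apply: eq_integral => y _ /=; rewrite xsectionE.
Qed.

Lemma bernoulli_map A : measurable A ->
  bernoulli_measure m (map_seq @^-1` A) = bernoulli_measure m' A.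
Proof.
pose F : {mfun sequences X >-> sequences X'} :=
  HB.pack map_seq (isMeasurableFun.Build _ _ _ _ _ measurable_map_seq).
move=> mA; apply: (bernoulli_unique (nu := distribution (bernoulli_measure m) F)) => //.
by move=> B [n /bernoulli_map_cyl].
Qed.

End law_invariance.

(** Two distinct coordinates have joint law [m \x m], as checked on rectangles, so null sets pull
    back to null sets. *)
Lemma ae_bernoulli_pair d (X : measurableType d) (R : realType)
    (m : probability X R) (Q : set (X * X)) i j : i != j ->
  {ae (m \x m), forall p, Q p} ->
  {ae bernoulli_measure m, forall x : sequences X, Q (x i, x j)}.
Proof.
move=> ij [N [mN N0 QN]].
have mij : measurable_fun setT (fun x : sequences X => (x i, x j)).
  by apply: measurable_fun_pair; exact: measurable_coord.
pose F : {mfun sequences X >-> (X * X)%type} :=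
  HB.pack (fun x : sequences X => (x i, x j)) (isMeasurableFun.Build _ _ _ _ _ mij).
exists (F @^-1` N); split.
- by have := mij measurableT _ mN; rewrite setTI.
- rewrite -[RHS]N0; apply/esym.
  apply: (product_measure_unique (m' := distribution (bernoulli_measure m) F)) => //.
  move=> A B mA mB; rewrite /distribution /pushforward /=.
  case: (ltngtP i j) => [lt|lt|eq].
  + by rewrite -(bernoulli_box2 m lt mA mB).
  + rewrite muleC -(bernoulli_box2 m lt mB mA); congr (bernoulli_measure m _).
    by apply/seteqP; split => x /= [].
  + by rewrite eq eqxx in ij.
- by move=> x; exact: QN.
Qed.

(** Applying T coordinatewise carries one Bernoulli measure to the other and almost surely preserves
    each of the countably many matrix entries; the diagonal ones are false on both sides. *)
Lemma measurable_graph_iso_law d d' (X : measurableType d) (X' : measurableType d')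
    (R : realType) (m : probability X R) (m' : probability X' R)
    (E : set (X * X)) (E' : set (X' * X')) :
  measurable E -> measurable E' -> measurable_graph_iso m E m' E' ->
  forall B : set adjacency_matrix, measurable B ->
    graph_law m E B = graph_law m' E' B.
Proof.
move=> mE mE' [T [mT mTE aeE]] B mB.
have mG d0 (Y : measurableType d0) (D : set (Y * Y)) : measurable D ->
    measurable (induced_graph D @^-1` B).
  by move=> mD; rewrite -[X in measurable X]setTI; exact: measurable_induced_graph.
rewrite /graph_law /pushforward -(bernoulli_map mT mTE); last exact: mG.
have : {ae bernoulli_measure m, forall x : sequences X,
    induced_graph E x = induced_graph E' (map_seq T x)}.
  pose Q (ij : nat * nat) (x : sequences X) := induced_graph E x ij = induced_graph E' (map_seq T x) ij.
  have : {ae bernoulli_measure m, forall x : sequences X,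
      forall k, Q (odflt (0%N, 0%N) (unpickle k)) x}.
    apply: ae_foralln => k; case: (odflt _ _) => i j.
    have [ij|ij] := eqVneq i j.
      by apply: aeW => x; rewrite /Q /induced_graph/= ij eqxx.
    have := ae_bernoulli_pair ij aeE; apply: filterS => x /= H.
    rewrite /Q /induced_graph/= ij/=.
    by apply/idP/idP; rewrite !inE => /H.
  apply: filterS => x xQ; apply/funext => ij.
  by have := xQ (pickle ij); rewrite pickleK.
move=> [N [mN N0 QN]].
have mA := mG _ _ _ mE; have mA' := measurable_map_seq_preimage mT (mG _ _ _ mE').
have NC : bernoulli_measure m (~` N) = 1.
  transitivity (1 - bernoulli_measure m N); first exact: probability_setC.
  by rewrite N0 sube0.
rewrite -(probability_setI1 mA (measurableC mN) NC).
rewrite -[RHS](probability_setI1 mA' (measurableC mN) NC).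
congr (bernoulli_measure m _); apply/seteqP.
have GE x : (~` N) x -> induced_graph E x = induced_graph E' (map_seq T x).
  by move=> Nx; apply: contrapT => /QN.
by split => x [Bx Nx]; split => //; move: Bx; rewrite /preimage/= GE.
Qed.

Theorem theorem6 (R : realType) (d d' : measure_display)
    (X : measurableType d) (X' : measurableType d')
    (m : probability X R) (m' : probability X' R)
    (E : set (X * X)) (E' : set (X' * X')) :
  universal_measurable_graph m E ->
  universal_measurable_graph m' E' ->
  ((forall B : set adjacency_matrix, measurable B ->
      graph_law m E B = graph_law m' E' B)
   <-> measurable_graph_iso m E m' E').
Proof.
move=> [[[complete _] _ mE symE _] _ _] [[leb atl mE' symE' _] pureE' _].
split; last exact: measurable_graph_iso_law.
(* Compactness is used in X', where points are constructed, and completeness in X, where preimages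
   are measured. *)
move=> law; have [lim reg] := lebesgue_space_captured_regular leb atl.
have [x [x' [gx gx' graph_eq]]] :=
  exists_common_graph mE mE' reg law (ae_good m mE) (ae_good m' mE').
have [X1 [mX1 X11 X1t X1_inj]] := pure_types mE' symE' pureE' gx'.
exact: (transport_iso mE mE' symE symE' graph_eq gx gx' reg complete mX1 X11).
Qed.
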